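(* There exist foliations $\mathcal F\in T_1$ that are not holomorphically equivalent to any foliation in $T_1$ defined by a polynomial equation, i.e. for which there is no germ of biholomorphism $\Phi:(\mathbb C^2,0)\to(\mathbb C^2,0)$ taking $\mathcal F$ to a foliation of $T_1$ defined by a $1$-form $P(x,y)\,dx+Q(x,y)\,dy$ with $P,Q\in\mathbb C[x,y]$.
   Context: $T_1$ denotes the set of germs at $0\in\mathbb C^2$ of holomorphic foliations defined by a $1$-form $\sum_{j\ge2}b_j(x,y)\,dx-\sum_{j\ge2}a_j(x,y)\,dy=0$, where $a_j,b_j$ are homogeneous polynomials of degree $j$ (the series converging near $0$), $a_2(x,y)=xy$, $b_2(x,y)=y^2$, and $x\,b_3(x,y)-y\,a_3(x,y)=\beta x^4$ for some $\beta\neq0$. After one blow-up $(x,t)\mapsto(x,tx)$ such a foliation becomes regular near the exceptional divisor, with exactly one tangency point with the divisor, of order $1$, located at $t=0$. Two germs of foliations are holomorphically equivalent if they are conjugated by a germ of holomorphic diffeomorphism of $(\mathbb C^2,0)$. *)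

(* Defs.v *)
(* Complex numbers are modelled as pairs of Stdlib reals;
   germs of holomorphic functions at 0 in C^2 as convergent power series
   in two variables (coefficient of x^i y^j at (i,j)). *)
From Stdlib Require Import Reals.
Open Scope R_scope.

Definition C : Type := (R * R)%type.
Definition C0 : C := (0, 0).
Definition C1 : C := (1, 0).
Definition Cadd (z w : C) : C := (fst z + fst w, snd z + snd w).
Definition Cneg (z : C) : C := (- fst z, - snd z).
Definition Cmul (z w : C) : C :=
  (fst z * fst w - snd z * snd w, fst z * snd w + snd z * fst w).
Definition Cnorm (z : C) : R := sqrt (fst z ^ 2 + snd z ^ 2).
Definition INC (n : nat) : C := (INR n, 0).

Fixpoint Csum (n : nat) (g : nat -> C) : C :=
  match n with
  | O => C0
  | S m => Cadd (Csum m g) (g m)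
  end.

(** * Power series in two variables: f i j = coefficient of x^i y^j *)
Definition Ser : Type := nat -> nat -> C.

Definition szero : Ser := fun _ _ => C0.
Definition monomial (p q : nat) : Ser :=
  fun i j => if andb (Nat.eqb i p) (Nat.eqb j q) then C1 else C0.
Definition sone : Ser := monomial 0 0.
Definition sX : Ser := monomial 1 0.
Definition sY : Ser := monomial 0 1.
Definition sadd (f g : Ser) : Ser := fun i j => Cadd (f i j) (g i j).
Definition sneg (f : Ser) : Ser := fun i j => Cneg (f i j).
Definition ssub (f g : Ser) : Ser := sadd f (sneg g).
Definition sscale (c : C) (f : Ser) : Ser := fun i j => Cmul c (f i j).
Definition smul (f g : Ser) : Ser := fun i j =>
  Csum (S i) (fun a => Csum (S j) (fun b => Cmul (f a b) (g (i - a)%nat (j - b)%nat))).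
Fixpoint spow (f : Ser) (n : nat) : Ser :=
  match n with
  | O => sone
  | S m => smul f (spow f m)
  end.
Definition homog (d : nat) (f : Ser) : Ser :=
  fun i j => if Nat.eqb (i + j) d then f i j else C0.
Definition sdx (f : Ser) : Ser := fun i j => Cmul (INC (S i)) (f (S i) j).
Definition sdy (f : Ser) : Ser := fun i j => Cmul (INC (S j)) (f i (S j)).

Definition convergent (f : Ser) : Prop :=
  exists r M : R, 0 < r /\ forall i j : nat, Cnorm (f i j) * r ^ (i + j) <= M.
Definition polynomial (f : Ser) : Prop :=
  exists N : nat, forall i j : nat, (N <= i + j)%nat -> f i j = C0.

Definition Map : Type := (Ser * Ser)%type.
(** composition f o (phi1, phi2), for phi1(0)=phi2(0)=0: coefficientwise a
    finite sum (terms with a+b > i+j vanish) *)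
Definition scomp (f : Ser) (Phi : Map) : Ser := fun i j =>
  Csum (S (i + j)) (fun a => Csum (S (i + j)) (fun b =>
    Cmul (f a b) (smul (spow (fst Phi) a) (spow (snd Phi) b) i j))).
Definition mcomp (Phi Psi : Map) : Map :=
  (scomp (fst Phi) Psi, scomp (snd Phi) Psi).
Definition mid : Map := (sX, sY).

Definition germ_map (Phi : Map) : Prop :=
  convergent (fst Phi) /\ convergent (snd Phi) /\
  fst Phi 0%nat 0%nat = C0 /\ snd Phi 0%nat 0%nat = C0.

Definition biholomorphism (Phi : Map) : Prop :=
  germ_map Phi /\
  exists Psi : Map, germ_map Psi /\ mcomp Phi Psi = mid /\ mcomp Psi Phi = mid.

(** * 1-forms P dx + Q dy, represented as (P, Q) *)
Definition Form : Type := (Ser * Ser)%type.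
Definition form_zero : Form := (szero, szero).

Definition pullback (Phi : Map) (w : Form) : Form :=
  let P := scomp (fst w) Phi in
  let Q := scomp (snd w) Phi in
  (sadd (smul P (sdx (fst Phi))) (smul Q (sdx (snd Phi))),
   sadd (smul P (sdy (fst Phi))) (smul Q (sdy (snd Phi)))).

(** w1 /\ w2 = wedge w1 w2 dx/\dy *)
Definition wedge (w1 w2 : Form) : Ser :=
  ssub (smul (fst w1) (snd w2)) (smul (snd w1) (fst w2)).

Definition same_foliation (w1 w2 : Form) : Prop :=
  w1 <> form_zero /\ w2 <> form_zero /\ wedge w1 w2 = szero.

(** The class T_1: w = B dx - A dy, A = sum_{j>=2} a_j, B = sum_{j>=2} b_j,
    a_2 = xy, b_2 = y^2, x b_3 - y a_3 = beta x^4 with beta <> 0,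
    series convergent. *)
Definition inT1 (w : Form) : Prop :=
  let B := fst w in
  let A := sneg (snd w) in
  convergent A /\ convergent B /\
  (forall i j : nat, (i + j < 2)%nat -> A i j = C0 /\ B i j = C0) /\
  homog 2 A = smul sX sY /\
  homog 2 B = smul sY sY /\
  exists beta : C, beta <> C0 /\
    ssub (smul sX (homog 3 B)) (smul sY (homog 3 A))
    = sscale beta (spow sX 4).

Definition takes_to (Phi : Map) (w w' : Form) : Prop :=
  same_foliation (pullback Phi w') w.

Definition polynomial_form (w : Form) : Prop :=
  polynomial (fst w) /\ polynomial (snd w).

(* Main.v *)
(* The foliation used is [B dx - A dy] with [A = xy + x^2 f(x)] and
   [B = x^3 + y^2 + xy f(x)], where the coefficients of
   [f = alpha_1 x + alpha_2 x^2 + ...] are real numbers in [[0, 1]] that are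
   algebraically independent over Q. After the blow-up [y = xt] it is spanned
   by [Z = (t + f(x)) d/dx + d/dt].

   A target foliation of T_1 becomes [dx - rho dt] after blowing up, and has a
   first integral [H] with [H(x, 0) = x]. If [(U, T)] is the blown-up
   conjugacy, then [G = H(U, T)] satisfies [Z G = 0], and [G(0, t) = H(0, m(t))]
   for a Moebius map [m]. Reading [Z G = 0] one power of [x] at a time recovers
   the [alpha_n] from [G(0, t)] rationally. Hence, if the target is defined by a
   polynomial form, all the [alpha_n] lie in a Q-algebra generated by finitely
   many complex numbers (the coefficients of that form, those of [m], and some
   inverses), which is impossible: [s ^ (d + 1)] monomials in [d + 1] elements
   of an algebra with [d] generators live in a space of dimension [O(s ^ d)]. *)
From Stdlib Require Import Reals Lra.
From HB Require Import structures.
From mathcomp Require Import all_boot all_order all_algebra.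
From mathcomp Require Import complex boolp Rstruct ring zify.
Require Import Defs.

Set Implicit Arguments.
Unset Strict Implicit.
Unset Printing Implicit Defensive.
Import GRing.Theory Num.Theory.
Local Open Scope ring_scope.

(** * Formal power series *)

Definition fps (R : Type) : Type := nat -> R.

HB.instance Definition _ (R : Type) := gen_eqMixin (fps R).
HB.instance Definition _ (R : Type) := gen_choiceMixin (fps R).

Section FpsRing.
Variable R : comNzRingType.
Implicit Types f g h : fps R.

Definition fps_add f g : fps R := fun n => f n + g n.
Definition fps_opp f : fps R := fun n => - f n.
Definition fps_zero : fps R := fun=> 0.

Fact fps_addA : associative fps_add.
Proof. by move=> f g h; apply/funext => n; rewrite /fps_add addrA. Qed.
Fact fps_addC : commutative fps_add.
Proof. by move=> f g; apply/funext => n; rewrite /fps_add addrC. Qed.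
Fact fps_add0 : left_id fps_zero fps_add.
Proof. by move=> f; apply/funext => n; rewrite /fps_add add0r. Qed.
Fact fps_addN : left_inverse fps_zero fps_opp fps_add.
Proof. by move=> f; apply/funext => n; rewrite /fps_add addNr. Qed.
HB.instance Definition _ := GRing.isZmodule.Build (fps R)
  fps_addA fps_addC fps_add0 fps_addN.

Definition fps_mul f g : fps R := fun n => \sum_(k < n.+1) f k * g (n - k)%N.
Definition fps_one : fps R := fun n => (n == 0%N)%:R.

Definition fps_trunc N f : {poly R} := \poly_(i < N) f i.

Lemma coef_fps_trunc N f i : (i < N)%N -> (fps_trunc N f)`_i = f i.
Proof. by move=> iN; rewrite coef_poly iN. Qed.

(** A coefficient of a product depends on finitely many coefficients of the factors, so
    commutativity, associativity and the Leibniz rule are inherited from [{poly R}]. *)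
Lemma fps_mul_trunc N f g n : (n < N)%N ->
  fps_mul f g n = (fps_trunc N f * fps_trunc N g)`_n.
Proof.
move=> nN; rewrite coefM; apply: eq_bigr => k _.
by rewrite !coef_fps_trunc //; have := ltn_ord k; lia.
Qed.

Fact fps_mulC : commutative fps_mul.
Proof.
by move=> f g; apply/funext => n; rewrite !(@fps_mul_trunc n.+1) // mulrC.
Qed.

Fact fps_mulA : associative fps_mul.
Proof.
move=> f g h; apply/funext => n.
transitivity (fps_trunc n.+1 f * fps_trunc n.+1 g * fps_trunc n.+1 h)`_n.
  rewrite -mulrA coefM; apply: eq_bigr => k _.
  by rewrite coef_fps_trunc // (@fps_mul_trunc n.+1) //; have := ltn_ord k; lia.
rewrite coefM; apply: eq_bigr => k _.
rewrite coef_fps_trunc; last by have := ltn_ord k; lia.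
by rewrite (@fps_mul_trunc n.+1).
Qed.

Fact fps_mul1 : left_id fps_one fps_mul.
Proof.
move=> f; apply/funext => n; rewrite /fps_mul big_ord_recl subn0 mul1r.
by rewrite big1 ?addr0 // => k _; rewrite mul0r.
Qed.

Fact fps_mulD : left_distributive fps_mul fps_add.
Proof.
move=> f g h; apply/funext => n; rewrite /fps_add /fps_mul -big_split.
by apply: eq_bigr => k _; rewrite mulrDl.
Qed.

Fact fps_oner_neq0 : fps_one != fps_zero.
Proof. by apply/eqP => /(congr1 (fun f => f 0%N))/eqP; rewrite oner_eq0. Qed.

HB.instance Definition _ := GRing.Zmodule_isComNzRing.Build (fps R)
  fps_mulA fps_mulC fps_mul1 fps_mulD fps_oner_neq0.

Lemma fpsD f g n : (f + g) n = f n + g n. Proof. by []. Qed.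
Lemma fpsB f g n : (f - g) n = f n - g n. Proof. by []. Qed.
Lemma fps0 n : (0 : fps R) n = 0. Proof. by []. Qed.
Lemma fps1 n : (1 : fps R) n = (n == 0%N)%:R. Proof. by []. Qed.
Lemma fpsM f g n : (f * g) n = \sum_(k < n.+1) f k * g (n - k)%N.
Proof. by []. Qed.
Lemma fps_sum I r (P : pred I) (F : I -> fps R) n :
  (\sum_(i <- r | P i) F i) n = \sum_(i <- r | P i) F i n.
Proof. by elim/big_ind2: _ => // _ y1 _ y2 <- <-. Qed.
Lemma fpsMn f m n : (f *+ m) n = f n *+ m.
Proof. by elim: m => // m IH; rewrite !mulrS fpsD IH. Qed.
Lemma fpsM0 f g : (f * g) 0%N = f 0%N * g 0%N.
Proof. by rewrite fpsM big_ord1. Qed.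
Lemma fpsX0 f n : (f ^+ n) 0%N = f 0%N ^+ n.
Proof. by elim: n => // n IH; rewrite !exprS fpsM0 IH. Qed.

Definition fpsC (c : R) : fps R := fun n => if n is 0 then c else 0.
Definition fpsX : fps R := fun n => (n == 1%N)%:R.

Lemma fpsCM c f n : (fpsC c * f) n = c * f n.
Proof.
rewrite fpsM big_ord_recl subn0 big1 ?addr0 // => k _.
by rewrite mul0r.
Qed.
Lemma fpsC0 : fpsC 0 = 0. Proof. by apply/funext; case. Qed.

Lemma fpsXM0 f : (fpsX * f) 0%N = 0.
Proof. by rewrite fpsM0 mul0r. Qed.
Lemma fpsXMS f n : (fpsX * f) n.+1 = f n.
Proof.
rewrite fpsM big_ord_recl mul0r add0r big_ord_recl mul1r big1 ?addr0 ?subn1 //.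
by move=> k _; rewrite mul0r.
Qed.

Lemma fpsX_inj f g : fpsX * f = fpsX * g -> f = g.
Proof.
by move=> E; apply/funext => n; rewrite -fpsXMS E fpsXMS.
Qed.

Lemma fpsXn_inj n f g : fpsX ^+ n * f = fpsX ^+ n * g -> f = g.
Proof.
by elim: n => [|n IH]; rewrite ?expr0 ?mul1r // exprS -!mulrA => /fpsX_inj.
Qed.

Lemma fpsXnM n f m : (fpsX ^+ n * f) m = if (n <= m)%N then f (m - n)%N else 0.
Proof.
elim: n m => [|n IH] [|m]; rewrite ?expr0 ?mul1r ?subn0 // exprS -mulrA.
  by rewrite fpsXM0.
by rewrite fpsXMS IH.
Qed.

Lemma fps_divXn n f : (forall m, (m < n)%N -> f m = 0) ->
  f = fpsX ^+ n * (fun m => f (n + m)%N).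
Proof.
move=> f0; apply/funext => m; rewrite fpsXnM; case: leqP => [nm|/f0//].
by rewrite subnKC.
Qed.

Definition fps_deriv f : fps R := fun n => f n.+1 *+ n.+1.

Lemma fps_derivD f g : fps_deriv (f + g) = fps_deriv f + fps_deriv g.
Proof. by apply/funext => n; rewrite /fps_deriv fpsD mulrnDl. Qed.

Lemma fps_derivM f g :
  fps_deriv (f * g) = fps_deriv f * g + f * fps_deriv g.
Proof.
apply/funext => n; rewrite fpsD {1}/fps_deriv.
rewrite -[(f * g) n.+1]/(fps_mul f g n.+1) (@fps_mul_trunc n.+2) // -coef_deriv.
rewrite derivM coefD !coefM; congr (_ + _); apply: eq_bigr => k _.
  by rewrite coef_deriv !coef_fps_trunc //; have := ltn_ord k; lia.
by rewrite coef_deriv !coef_fps_trunc //; have := ltn_ord k; lia.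
Qed.

(* With [S] a subring and [N n0] the lowest coefficient of [N] this is exact
   division; with [S = {0}] it says that [N] is not a zero divisor. *)
Lemma fps_div_closed (S : R -> Prop) (N : fps R) n0 :
  S 0 -> (forall x y, S x -> S y -> S (x - y)) ->
  (forall x i, S x -> S (x * N i)) ->
  (forall i, (i < n0)%N -> N i = 0) -> (forall x, S (x * N n0) -> S x) ->
  forall f, (forall i, S ((f * N) i)) -> forall i, S (f i).
Proof.
move=> S0 SB SN N0 Nn0 f SfN i.
elim/ltn_ind: i => i IH; apply: Nn0.
have := SfN (i + n0)%N; rewrite fpsM.
rewrite -(big_mkord xpredT (fun k => f k * N (i + n0 - k)%N)).
rewrite (@big_cat_nat _ _ _ i) //=; last by lia.
rewrite (@big_cat_nat _ _ _ i.+1 i) //=; last by lia.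
rewrite big_nat1 addKn [X in _ + (_ + X)]big_nat [X in _ + (_ + X)]big1.
  2: by move=> k /andP[ik kn]; rewrite N0 ?mulr0 //; lia.
rewrite addr0.
have SD x y : S x -> S y -> S (x + y).
  by move=> Sx Sy; rewrite -[y]opprK -[- y]sub0r; apply: (SB) => //; apply: SB.
set A := \sum_(_ <= _ < _) _ => SA.
suff SA' : S A by rewrite -[_ * _](addKr A) addrC; apply: SB.
by rewrite /A big_nat; apply: big_ind => // k ki; apply: SN; apply: IH.
Qed.

Lemma fps_lowest (f : fps R) : f != 0 ->
  exists2 n, f n != 0 & forall i, (i < n)%N -> f i = 0.
Proof.
move=> /eqP f0; have [n fn] : exists n, f n != 0.
  apply: contrapT => H; apply: f0; apply/funext => n; apply/eqP.
  by apply: contrapT => /negP fn; apply: H; exists n.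
have ex : exists n, f n != 0 by exists n.
case: (ex_minnP ex) => m fm min; exists m => // i im; apply/eqP.
by apply: contraTT im => /min; rewrite leqNgt.
Qed.

Lemma fps_mulI (N : fps R) n0 :
  (forall i, (i < n0)%N -> N i = 0) -> (forall x, x * N n0 = 0 -> x = 0) ->
  forall f, f * N = 0 -> f = 0.
Proof.
move=> N0 Nn0 f fN; apply/funext => i.
apply: (fps_div_closed (S := fun x => x = 0)) (N0) (Nn0) _ _ _ => //.
- by move=> x y -> ->; rewrite subr0.
- by move=> x j ->; rewrite mul0r.
by move=> j; rewrite fN.
Qed.
End FpsRing.

(** * Series in two variables and substitution *)

Section Bivariate.
Variable K : comNzRingType.
(** The outer index is the exponent of [x], the inner one that of [t]. Thus [f 0] is the restriction
    to [x = 0], which is the exceptional divisor after blowing up. *)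
Notation fps2 := (fps (fps K)).
Implicit Types (f g h a b : fps2) (i j m n p q : nat).

Definition cst2 (c : K) : fps2 := fpsC (fpsC c).
Definition vx : fps2 := fpsX (fps K).
Definition vt : fps2 := fpsC (fpsX K).

Lemma fps2M f g i j :
  (f * g) i j = \sum_(k < i.+1) \sum_(l < j.+1) f k l * g (i - k)%N (j - l)%N.
Proof. by rewrite fpsM fps_sum. Qed.
Lemma fps2D f g i j : (f + g) i j = f i j + g i j. Proof. by []. Qed.
Lemma fps2N f i j : (- f) i j = - f i j. Proof. by []. Qed.
Lemma fps2_1 i j : (1 : fps2) i j = ((i == 0) && (j == 0))%N%:R.
Proof. by rewrite fps1; case: i. Qed.
Lemma fps2M00 f g : (f * g) 0%N 0%N = f 0%N 0%N * g 0%N 0%N.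
Proof. by rewrite !fpsM0. Qed.

Lemma cst2M c f i j : (cst2 c * f) i j = c * f i j.
Proof. by rewrite fpsCM fpsCM. Qed.
Lemma cst2_1 : cst2 1 = 1.
Proof. by apply/funext => -[|i]; apply/funext => -[|j]. Qed.

Lemma vxM0 f : (vx * f) 0%N = 0. Proof. exact: fpsXM0. Qed.
Lemma vxMS f i : (vx * f) i.+1 = f i. Proof. exact: fpsXMS. Qed.
Lemma vxn_inj n f g : vx ^+ n * f = vx ^+ n * g -> f = g.
Proof. exact: fpsXn_inj. Qed.
Lemma vx_inj f g : vx * f = vx * g -> f = g.
Proof. exact: fpsX_inj. Qed.
Lemma vtM f i : (vt * f) i = fpsX K * f i. Proof. exact: fpsCM. Qed.
Lemma vtM0 f i : (vt * f) i 0%N = 0. Proof. by rewrite vtM fpsXM0. Qed.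
Lemma vtMS f i j : (vt * f) i j.+1 = f i j.
Proof. by rewrite vtM fpsXMS. Qed.

(** Membership in the [n]-th power of the maximal ideal [(x, t)]. *)
Definition low n f := forall i j, (i + j < n)%N -> f i j = 0.

Lemma lowD n f g : low n f -> low n g -> low n (f + g).
Proof. by move=> lf lg i j ij; rewrite fps2D lf ?lg ?addr0. Qed.
Lemma lowN n f : low n f -> low n (- f).
Proof. by move=> lf i j ij; rewrite fps2N lf ?oppr0. Qed.
Lemma low_le m n f : (m <= n)%N -> low n f -> low m f.
Proof. by move=> mn lf i j ij; apply: lf; lia. Qed.
Lemma low1 f : f 0%N 0%N = 0 -> low 1 f.
Proof. by move=> f0 [|i] [|j]; rewrite ?addSn ?addnS. Qed.

Lemma lowM m n f g : low m f -> low n g -> low (m + n) (f * g).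
Proof.
move=> lf lg i j ij; rewrite fps2M big1 // => k _; rewrite big1 // => l _.
have [kl|kl] := ltnP (k + l) m; first by rewrite lf ?mul0r.
by rewrite lg ?mulr0 //; have := ltn_ord k; have := ltn_ord l; lia.
Qed.

Lemma lowX m f : f 0%N 0%N = 0 -> low m (f ^+ m).
Proof.
move=> f0; elim: m => [|m IH]; first by move=> i j.
by rewrite exprS -add1n; apply: lowM => //; apply: low1.
Qed.

Lemma low_eq0 f : (forall n, low n f) -> f = 0.
Proof. by move=> lf; do 2 apply/funext => ?; apply: lf (ltnSn _). Qed.

Definition dx f : fps2 := fps_deriv f.
Definition dt f : fps2 := fun i => fps_deriv (f i).

Lemma dxE f i j : dx f i j = f i.+1 j *+ i.+1.
Proof. by rewrite /dx /fps_deriv fpsMn. Qed.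
Lemma dtE f i j : dt f i j = f i j.+1 *+ j.+1.
Proof. by []. Qed.

(** All terms divisible by [x] go to [shx]; [shy] receives only the pure powers of [t]. This
    splitting drives the induction in [low_rec]. *)
Definition shx f : fps2 := fun i => f i.+1.
Definition shy f : fps2 := fpsC ((fun j => f 0%N j.+1) : fps K).

Lemma fps2_decomp f : f = cst2 (f 0%N 0%N) + vx * shx f + vt * shy f.
Proof.
apply/funext => -[|i]; apply/funext => -[|j];
  by rewrite !fps2D ?vxM0 ?vxMS ?vtM0 ?vtMS ?addr0 ?add0r.
Qed.

Definition vfield P Q f := P * dx f + Q * dt f.

Lemma dxD f g : dx (f + g) = dx f + dx g. Proof. exact: fps_derivD. Qed.
Lemma dtD f g : dt (f + g) = dt f + dt g.
Proof. by apply/funext => i; rewrite [LHS]fps_derivD. Qed.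
Lemma dxM f g : dx (f * g) = dx f * g + f * dx g.
Proof. exact: fps_derivM. Qed.
Lemma dtM f g : dt (f * g) = dt f * g + f * dt g.
Proof.
apply/funext => i; rewrite /dt fpsD !fpsM -big_split /=.
under [RHS]eq_bigr => k _ do rewrite -fps_derivM.
elim/big_ind2: _ => [|? u ? v <- <-|//]; last by rewrite fps_derivD.
by apply/funext => j; rewrite /fps_deriv mul0rn.
Qed.
Lemma dx_cst c : dx (cst2 c) = 0.
Proof. by do 2 apply/funext => ?; rewrite dxE mul0rn. Qed.
Lemma dt_cst c : dt (cst2 c) = 0.
Proof. by apply/funext => -[|i]; apply/funext => j; rewrite dtE mul0rn. Qed.
Lemma dx_vx : dx vx = 1.
Proof.
apply/funext => -[|[|i]]; apply/funext => -[|j]; rewrite dxE //= ?mul0rn //.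
Qed.
Lemma dx_vt : dx vt = 0.
Proof. by do 2 apply/funext => ?; rewrite dxE mul0rn. Qed.
Lemma dt_vx : dt vx = 0.
Proof.
by apply/funext => -[|[|i]]; apply/funext => -[|j]; rewrite dtE mul0rn.
Qed.
Lemma dt_vt : dt vt = 1.
Proof.
by apply/funext => -[|i]; apply/funext => -[|[|j]]; rewrite dtE ?mul0rn.
Qed.

Lemma vfieldD P Q f g : vfield P Q (f + g) = vfield P Q f + vfield P Q g.
Proof. by rewrite /vfield dxD dtD; ring. Qed.
Lemma vfieldM P Q f g :
  vfield P Q (f * g) = vfield P Q f * g + f * vfield P Q g.
Proof. by rewrite /vfield dxM dtM; ring. Qed.
Lemma vfield10 f : vfield 1 0 f = dx f.
Proof. by rewrite /vfield mul1r mul0r addr0. Qed.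
Lemma vfield01 f : vfield 0 1 f = dt f.
Proof. by rewrite /vfield mul1r mul0r add0r. Qed.
Lemma vfield_cst P Q c : vfield P Q (cst2 c) = 0.
Proof. by rewrite /vfield dx_cst dt_cst !mulr0 addr0. Qed.

(* [subst2 a b f] is [f (a, b)]; meaningful when [a] and [b] have no constant
   term, since then the omitted terms do not contribute. *)
Definition subst2 a b f : fps2 := fun i j =>
  \sum_(p < (i + j).+1) \sum_(q < (i + j).+1) f p q * (a ^+ p * b ^+ q) i j.

Definition psubst M N a b f : fps2 :=
  \sum_(p < M) \sum_(q < N) cst2 (f p q) * (a ^+ p * b ^+ q).

(** * Substitution as a ring morphism, and the chain rule *)

Section Subst.
Variables a b : fps2.
Hypotheses (a0 : a 0%N 0%N = 0) (b0 : b 0%N 0%N = 0).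

Let lowab p q : low (p + q) (a ^+ p * b ^+ q).
Proof. by apply: lowM; apply: lowX. Qed.

(** The summation range of [subst2] moves with the coefficient. A fixed rectangle gives the same
    value because [a ^+ p * b ^+ q] has order at least [p + q], and it can be handled as a finite
    sum of ring elements. *)
Lemma subst2E M N f i j : (i + j < M)%N -> (i + j < N)%N ->
  subst2 a b f i j = psubst M N a b f i j.
Proof.
move=> HM HN; rewrite /psubst !fps_sum.
under [RHS]eq_bigr => p _.
  rewrite !fps_sum; under eq_bigr => q _ do rewrite cst2M; over.
pose F p q := f p q * (a ^+ p * b ^+ q) i j.
have F0 p q : (i + j < p + q)%N -> F p q = 0.
  by move=> pq; rewrite /F lowab ?mulr0.
rewrite /subst2 -/(F _ _).
rewrite (big_ord_widen_cond M xpredT (fun p => \sum_(q < (i+j).+1) F p q)) //.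
rewrite big_mkcond /=; apply: eq_bigr => p _.
rewrite (big_ord_widen_cond N xpredT (fun q => F p q)) // big_mkcond /=.
case: ltnP => [_|pij].
  by apply: eq_bigr => q _; case: ltnP => // /= qij; rewrite -/(F p q) F0 //; lia.
by rewrite big1 // => q _; rewrite -/(F p q) F0 //; lia.
Qed.

Lemma subst2D f g : subst2 a b (f + g) = subst2 a b f + subst2 a b g.
Proof.
apply/funext => i; apply/funext => j.
rewrite fps2D /subst2 -big_split; apply: eq_bigr => p _.
by rewrite -big_split; apply: eq_bigr => q _ /=; rewrite -mulrDl.
Qed.

Lemma subst2_0 : subst2 a b 0 = 0.
Proof.
apply/funext => i; apply/funext => j; rewrite /subst2.
by rewrite big1 // => p _; rewrite big1 // => q _; rewrite mul0r.
Qed.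

Lemma subst2N f : subst2 a b (- f) = - subst2 a b f.
Proof.
by apply/eqP; rewrite -subr_eq0 opprK -subst2D addNr subst2_0.
Qed.

Lemma subst2_cstM c f : subst2 a b (cst2 c * f) = cst2 c * subst2 a b f.
Proof.
apply/funext => i; apply/funext => j; rewrite cst2M /subst2 mulr_sumr.
apply: eq_bigr => p _; rewrite mulr_sumr; apply: eq_bigr => q _.
by rewrite cst2M mulrA.
Qed.

Lemma low_subst2 n f : low n f -> low n (subst2 a b f).
Proof.
move=> lf i j ij; rewrite /subst2 big1 // => p _; rewrite big1 // => q _.
have [pq|pq] := ltnP (p + q) n; first by rewrite lf ?mul0r.
by rewrite lowab ?mulr0 //; lia.
Qed.

Lemma psubstS M N f : psubst M.+1 N.+1 a b f =
  cst2 (f 0%N 0%N) + a * psubst M N.+1 a b (shx f) + b * psubst M.+1 N a b (shy f).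
Proof.
rewrite {1}/psubst big_ord_recl big_ord_recl.
have -> : \sum_(p < M) \sum_(q < N.+1)
    cst2 (f (lift ord0 p) q) * (a ^+ lift ord0 p * b ^+ q) =
    a * psubst M N.+1 a b (shx f).
  rewrite /psubst mulr_sumr; apply: eq_bigr => p _.
  rewrite mulr_sumr; apply: eq_bigr => q _.
  by rewrite /shx lift0 exprS; ring.
have -> : \sum_(q < N)
    cst2 (f (@ord0 M) (lift ord0 q)) * (a ^+ (@ord0 M) * b ^+ lift ord0 q) =
    b * psubst M.+1 N a b (shy f).
  (* [shy f] contains no positive power of [x], so only the terms with [p = 0] survive. *)
  rewrite /psubst big_ord_recl [X in b * (_ + X)]big1 ?addr0; last first.
    move=> p _; rewrite big1 // => q _.
    by rewrite -[cst2 _]/(fpsC (fpsC 0)) !fpsC0 mul0r.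
  rewrite mulr_sumr; apply: eq_bigr => q _.
  by rewrite /shy lift0 exprS /=; ring.
by rewrite !expr0 !mulr1; ring.
Qed.

Lemma lowMl n f g : low n g -> low n (f * g).
Proof. by move=> lg; rewrite -[n]add0n; apply: lowM. Qed.

Lemma subst2_decomp f : subst2 a b f =
  cst2 (f 0%N 0%N) + a * subst2 a b (shx f) + b * subst2 a b (shy f).
Proof.
apply/funext => i; apply/funext => j.
pose n := (i + j).+1.
have lowS M N g : (n <= M)%N -> (n <= N)%N ->
    low n (psubst M N a b g - subst2 a b g).
  move=> nM nN i' j' ij'; rewrite fps2D fps2N -subst2E ?subrr //; lia.
rewrite (@subst2E n.+1 n.+1); try by rewrite /n; lia.
rewrite psubstS.
have := lowMl a (@lowS n n.+1 (shx f) (leqnn _) (leqnSn _)) (ltnSn (i + j)).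
have := lowMl b (@lowS n.+1 n (shy f) (leqnSn _) (leqnn _)) (ltnSn (i + j)).
rewrite !mulrBr !(fps2D, fps2N) => /subr0_eq -> /subr0_eq -> //.
Qed.

(** Each use of the recursion gains a factor from the maximal ideal, so [E f] lies in all its
    powers. To prove an identity for all series, [E] is taken to be the difference of its two
    sides. *)
Lemma low_rec (E : fps2 -> fps2) (u v : fps2) : u 0%N 0%N = 0 -> v 0%N 0%N = 0 ->
  (forall f, E f = u * E (shx f) + v * E (shy f)) -> forall f, E f = 0.
Proof.
move=> u0 v0 Ef f; apply: low_eq0 => n; elim: n f => [|n IH] f; first by [].
by rewrite Ef -add1n; apply: lowD; apply: lowM => //; apply: low1.
Qed.

Lemma subst2_vxM f : subst2 a b (vx * f) = a * subst2 a b f.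
Proof.
rewrite subst2_decomp vxM0 (_ : shx _ = f); last first.
  by apply/funext => i; rewrite /shx vxMS.
rewrite (_ : shy _ = 0) ?subst2_0 ?mulr0 ?addr0; last first.
  by apply/funext => -[|i]; apply/funext => j //; rewrite /shy /= vxM0.
by rewrite /cst2 !fpsC0 add0r.
Qed.

Lemma subst2_vtM f : subst2 a b (vt * f) = b * subst2 a b f.
Proof.
apply/subr0_eq; move: f.
(* Multiplication by [t] commutes with [shx], so the recursion can descend along [x] alone, with
   [v = 0]. *)
apply: (@low_rec (fun f => subst2 a b (vt * f) - b * subst2 a b f) a 0) => // f.
rewrite mul0r addr0 {1}subst2_decomp vtM0 /cst2 !fpsC0 add0r.
rewrite (_ : shx _ = vt * shx f); last first.
  by apply/funext => i; rewrite /shx !vtM.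
rewrite (_ : shy _ = fpsC (f 0%N)); last first.
  by apply/funext => -[|i] //; apply/funext => j; rewrite /shy /= vtMS.
rewrite {3}(_ : f = vx * shx f + fpsC (f 0%N)); last first.
  apply/funext => -[|i]; rewrite fpsD ?vxM0 ?vxMS ?add0r //.
  by apply/funext => j; rewrite fpsD addr0.
by rewrite subst2D subst2_vxM; ring.
Qed.

Lemma subst2M f g : subst2 a b (f * g) = subst2 a b f * subst2 a b g.
Proof.
apply/subr0_eq; move: f.
pose E f := subst2 a b (f * g) - subst2 a b f * subst2 a b g.
apply: (@low_rec E a b) => // f; rewrite /E.
rewrite {1}[f]fps2_decomp !mulrDl -!mulrA !subst2D subst2_cstM subst2_vxM.
by rewrite subst2_vtM [subst2 a b f]subst2_decomp; ring.
Qed.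

Lemma subst2_cst c : subst2 a b (cst2 c) = cst2 c.
Proof.
rewrite subst2_decomp (_ : shx _ = 0) 1?(_ : shy _ = 0) ?subst2_0.
- by rewrite !mulr0 !addr0.
- by apply/funext => -[|i]; apply/funext => j.
by apply/funext => i.
Qed.

Lemma subst2_vx : subst2 a b vx = a.
Proof.
by rewrite -[vx]mulr1 subst2_vxM -cst2_1 subst2_cst cst2_1 mulr1.
Qed.

Lemma subst2_vt : subst2 a b vt = b.
Proof.
by rewrite -[vt]mulr1 subst2_vtM -cst2_1 subst2_cst cst2_1 mulr1.
Qed.

Lemma subst2X f n : subst2 a b (f ^+ n) = subst2 a b f ^+ n.
Proof.
elim: n => [|n IH]; first by rewrite !expr0 -cst2_1 subst2_cst.
by rewrite !exprS subst2M IH.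
Qed.

Lemma subst2_00 f : subst2 a b f 0%N 0%N = f 0%N 0%N.
Proof.
by rewrite subst2_decomp !fps2D !fps2M00 a0 b0 !mul0r !addr0.
Qed.

Lemma subst2_chain P Q f : vfield P Q (subst2 a b f) =
  subst2 a b (dx f) * vfield P Q a + subst2 a b (dt f) * vfield P Q b.
Proof.
apply/subr0_eq; move: f.
pose E f := vfield P Q (subst2 a b f) -
  (subst2 a b (dx f) * vfield P Q a + subst2 a b (dt f) * vfield P Q b).
apply: (@low_rec E a b) => // f; rewrite /E.
have -> : dx f = shx f + vx * dx (shx f) + vt * dx (shy f).
  by rewrite {1}[f]fps2_decomp !dxD !dxM dx_cst dx_vx dx_vt; ring.
have -> : dt f = vx * dt (shx f) + (shy f + vt * dt (shy f)).
  by rewrite {1}[f]fps2_decomp !dtD !dtM dt_cst dt_vx dt_vt; ring.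
rewrite [subst2 a b f]subst2_decomp !vfieldD !vfieldM vfield_cst.
by rewrite !subst2D !subst2M subst2_vx subst2_vt; ring.
Qed.

(** The chain rule at the origin; with [subst2_01] it gives the Jacobian matrix of a composite. *)
Lemma subst2_10 f : subst2 a b f 1%N 0%N =
  f 1%N 0%N * a 1%N 0%N + f 0%N 1%N * b 1%N 0%N.
Proof.
have := congr1 (fun g : fps2 => g 0%N 0%N) (subst2_chain 1 0 f).
by rewrite !vfield10 fps2D 2!fps2M00 !subst2_00 !dxE dtE !mulr1n.
Qed.

Lemma subst2_01 f : subst2 a b f 0%N 1%N =
  f 1%N 0%N * a 0%N 1%N + f 0%N 1%N * b 0%N 1%N.
Proof.
have := congr1 (fun g : fps2 => g 0%N 0%N) (subst2_chain 0 1 f).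
by rewrite !vfield01 fps2D 2!fps2M00 !subst2_00 dxE !dtE !mulr1n.
Qed.
End Subst.

Lemma subst2A a b (c d : fps2) f :
  a 0%N 0%N = 0 -> b 0%N 0%N = 0 -> c 0%N 0%N = 0 -> d 0%N 0%N = 0 ->
  subst2 c d (subst2 a b f) = subst2 (subst2 c d a) (subst2 c d b) f.
Proof.
move=> a0 b0 c0 d0; apply/subr0_eq; move: f.
have a'0 : subst2 c d a 0%N 0%N = 0 by rewrite subst2_00.
have b'0 : subst2 c d b 0%N 0%N = 0 by rewrite subst2_00.
pose E f := subst2 c d (subst2 a b f) - subst2 (subst2 c d a) (subst2 c d b) f.
apply: (@low_rec E _ _ a'0 b'0) => f; rewrite /E.
rewrite [subst2 a b f]subst2_decomp // [X in _ - X]subst2_decomp //.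
rewrite (subst2D c d) (subst2D c d) !(subst2M c0 d0) (subst2_cst c0 d0).
move: (subst2 c d (subst2 a b (shx f))) (subst2 c d (subst2 a b (shy f))).
move: (subst2 c d a) (subst2 c d b) {a'0 b'0 E} => a' b' u v.
by move: (subst2 a' b' (shx f)) (subst2 a' b' (shy f)) => u' v'; ring.
Qed.

(* [1 / (1 - n)] is the geometric series at [n]. *)
Lemma fps2_inv f (r : K) : r * f 0%N 0%N = 1 -> exists g, f * g = 1.
Proof.
move=> rf; pose n := 1 - cst2 r * f.
have n0 : n 0%N 0%N = 0 by rewrite /n fps2D fps2N fps2_1 cst2M rf subrr.
pose geo : fps2 := fun i j => (j == 0)%N%:R.
have geoE : geo * (1 - vx) = 1.
  apply/funext => -[|i]; apply/funext => j.
    by rewrite mulrBr mulr1 mulrC fps2D fps2N vxM0 subr0 fps2_1.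
  by rewrite mulrBr mulr1 mulrC fps2D fps2N vxMS subrr.
have := congr1 (subst2 n 0) geoE.
rewrite subst2M // subst2D // subst2N // subst2_vx // -cst2_1 subst2_cst //.
rewrite cst2_1 /n opprB addrCA subrr addr0 => E.
by exists (cst2 r * subst2 n 0 geo); rewrite -E; ring.
Qed.
End Bivariate.

(** * Coefficients in a subring *)

Definition subring_pred (R : comNzRingType) (S : R -> Prop) :=
  [/\ S 1, forall x y, S x -> S y -> S (x - y)
    & forall x y, S x -> S y -> S (x * y)].

Definition fps_over (R : Type) (S : R -> Prop) (f : fps R) :=
  forall i, S (f i).

Section SubringPred.
Variables (R : comNzRingType) (S : R -> Prop).
Hypothesis subS : subring_pred S.

Lemma subring_pred1 : S 1. Proof. by case: subS. Qed.
Lemma subring_predB x y : S x -> S y -> S (x - y).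
Proof. by case: subS => _ + _; apply. Qed.
Lemma subring_predM x y : S x -> S y -> S (x * y).
Proof. by case: subS => _ _; apply. Qed.
Lemma subring_pred0 : S 0.
Proof. by rewrite -(subrr 1); apply: subring_predB; apply: subring_pred1. Qed.
Lemma subring_predN x : S x -> S (- x).
Proof.
by move=> Sx; rewrite -sub0r; apply: subring_predB => //; apply: subring_pred0.
Qed.
Lemma subring_predD x y : S x -> S y -> S (x + y).
Proof.
by move=> Sx Sy; rewrite -[y]opprK; apply: subring_predB => //; apply: subring_predN.
Qed.
Lemma subring_pred_sum I r (P : pred I) (F : I -> R) :
  (forall i, P i -> S (F i)) -> S (\sum_(i <- r | P i) F i).
Proof.
by move=> SF; apply: big_ind => //; [apply: subring_pred0|apply: subring_predD].
Qed.
Lemma subring_predX x n : S x -> S (x ^+ n).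
Proof.
move=> Sx; elim: n => [|n IH]; first exact: subring_pred1.
by rewrite exprS; apply: subring_predM.
Qed.
Lemma subring_predMn x n : S x -> S (x *+ n).
Proof.
move=> Sx; elim: n => [|n IH]; first exact: subring_pred0.
by rewrite mulrS; apply: subring_predD.
Qed.

Lemma fps_over_subring : subring_pred (fps_over S).
Proof.
split=> [i|f g Sf Sg i|f g Sf Sg i].
- rewrite fps1; case: eqP => _; [exact: subring_pred1|exact: subring_pred0].
- by rewrite fpsB; apply: subring_predB.
by rewrite fpsM; apply: subring_pred_sum => k _; apply: subring_predM.
Qed.

Lemma fps_overX : fps_over S (fpsX R).
Proof.
move=> i; rewrite /fpsX; case: eqP => _; [exact: subring_pred1|].
exact: subring_pred0.
Qed.

Lemma fps_overC c : S c -> fps_over S (fpsC c).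
Proof. by move=> Sc [|i] //; apply: subring_pred0. Qed.

Lemma fps_over_deriv f : fps_over S f -> fps_over S (fps_deriv f).
Proof. by move=> Sf i; apply: subring_predMn. Qed.
End SubringPred.

Section Bivariate_over.
Variables (K : fieldType) (S : K -> Prop).
Hypothesis subS : subring_pred S.
Notation fps2 := (fps (fps K)).
Notation S1 := (fps_over S).
Notation S2 := (fps_over (fps_over S)).
Let subS1 : subring_pred S1 := fps_over_subring subS.
Let subS2 : subring_pred S2 := fps_over_subring subS1.

Lemma subst2_over (a b f : fps2) : S2 a -> S2 b -> S2 f -> S2 (subst2 a b f).
Proof.
move=> Sa Sb Sf i j; rewrite /subst2.
apply: subring_pred_sum => // p _; apply: subring_pred_sum => // q _.
apply: subring_predM => //; first exact: (Sf p q).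
suff H : S2 (a ^+ p * b ^+ q) by exact: (H i j).
by apply: (subring_predM subS2); apply: (subring_predX subS2).
Qed.

(** Setting [x = 0] is a ring morphism, so only [a 0] and [b 0] matter. The conjugacy will be
    controlled along the exceptional divisor only. *)
Lemma subst2_over0 (a b f : fps2) : S1 (a 0%N) -> S1 (b 0%N) -> S2 f ->
  S1 (subst2 a b f 0%N).
Proof.
move=> Sa Sb Sf j; rewrite /subst2.
apply: subring_pred_sum => // p _; apply: subring_pred_sum => // q _.
apply: subring_predM => //; first exact: (Sf p q).
suff H : S1 ((a ^+ p * b ^+ q) 0%N) by exact: (H j).
rewrite fpsM0 !fpsX0.
by apply: (subring_predM subS1); apply: (subring_predX subS1).
Qed.

Lemma fps_over_div (N f : fps K) : N 0%N != 0 -> S (N 0%N)^-1 -> S1 N ->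
  S1 (f * N) -> S1 f.
Proof.
move=> N0 Sl SN SfN; apply: (@fps_div_closed _ S N 0%N) => //.
- exact: subring_pred0.
- exact: subring_predB.
- by move=> x i Sx; apply: subring_predM.
by move=> x Sx; rewrite -[x](mulfK N0); apply: subring_predM.
Qed.
End Bivariate_over.

Lemma fps2_mulI (K : fieldType) (N f : fps (fps K)) : N != 0 -> f * N = 0 -> f = 0.
Proof.
move=> /fps_lowest[i Ni i0]; apply: (fps_mulI i0) => x.
have [j Nij j0] := fps_lowest Ni; apply: (fps_mulI j0) => y /eqP.
by rewrite mulf_eq0 (negPf Nij) orbF => /eqP.
Qed.

(* [l] is the inverse of the lexicographically lowest coefficient. *)
Lemma fps2_over_div (K : fieldType) (N : fps (fps K)) : N != 0 ->
  exists l : K, forall S, subring_pred S -> fps_over (fps_over S) N -> S l ->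
    forall f, fps_over (fps_over S) (f * N) -> fps_over (fps_over S) f.
Proof.
move=> /fps_lowest[i Ni i0]; have [j Nij j0] := fps_lowest Ni.
exists (N i j)^-1 => S subS SN Sl f SfN.
have subS1 := fps_over_subring subS.
apply: (@fps_div_closed _ (fps_over S) N i) => //.
- exact: subring_pred0.
- exact: subring_predB.
- by move=> x k Sx; apply: (subring_predM subS1).
move=> x Sx; apply: (@fps_div_closed _ S (N i) j) => //.
- exact: subring_pred0.
- exact: subring_predB.
- by move=> y k Sy; apply: (subring_predM subS) => //; apply: (SN i k).
by move=> y Sy; rewrite -[y](mulfK Nij); apply: subring_predM.
Qed.

(** * The blow-up *)

Section Blowup.
Variable K : fieldType.
Notation fps2 := (fps (fps K)).
Implicit Types f g : fps2.
Notation x := (vx K).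
Notation t := (vt K).

Definition blowup f : fps2 := subst2 x (x * t) f.

Lemma vx00 : x 0%N 0%N = 0. Proof. by []. Qed.
Lemma vxt00 : (x * t) 0%N 0%N = 0. Proof. by rewrite fps2M00 mul0r. Qed.

(** The monomial [x^p y^q] becomes [x^(p+q) t^q]. Distinct monomials stay distinct, whence
    [blowup_inj]. *)
Lemma blowupE f i j : blowup f i j = if (j <= i)%N then f (i - j)%N j else 0.
Proof.
pose bl f : fps2 := fun i j => if (j <= i)%N then f (i - j)%N j else 0.
suff -> : blowup f = bl f by [].
apply/subr0_eq; move: f.
apply: (@low_rec _ (fun f => blowup f - bl f) x (x * t)) => [||f].
- exact: vx00.
- exact: vxt00.
have -> : bl f = cst2 (f 0%N 0%N) + x * bl (shx f) + x * t * bl (shy f).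
  apply/funext => -[|m]; apply/funext => n.
    by rewrite -!mulrA !fps2D !vxM0 !addr0; case: n.
  rewrite -!mulrA !fps2D !vxMS add0r /bl; case: n => [|n].
    by rewrite vtM0 addr0 !subn0.
  rewrite vtMS /shx /shy subSS ltnS; case: (ltngtP n m) => nm /=.
  - by rewrite -subSn // subSS; case E: (m - n)%N => [|k]; [lia|rewrite addr0].
  - by rewrite addr0.
  by rewrite nm subnn add0r.
rewrite /blowup [subst2 _ _ f]subst2_decomp ?vx00 ?vxt00 //.
move: (subst2 x (x * t) (shx f)) (subst2 x (x * t) (shy f)) => u v.
by move: (bl (shx f)) (bl (shy f)) => u' v'; ring.
Qed.

Lemma blowup_inj f : blowup f = 0 -> f = 0.
Proof.
move=> f0; apply/funext => i; apply/funext => j.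
have := blowupE f (i + j)%N j; rewrite f0 leq_addl addnK => <- //.
Qed.

Lemma blowup_col0 f : blowup f 0%N = fpsC (f 0%N 0%N).
Proof. by apply/funext => -[|j]; rewrite blowupE. Qed.

(** On the divisor, [g] is the homogeneous part of degree [n] of [f] evaluated at [(1, t)]. *)
Lemma blowup_low n f : low n f -> exists2 g : fps2, blowup f = x ^+ n * g
  & forall j, g 0%N j = if (j <= n)%N then f (n - j)%N j else 0.
Proof.
move=> lf; exists (fun m => blowup f (n + m)%N) => [|j].
  apply: fps_divXn => m mn; apply/funext => j; rewrite blowupE.
  by case: leqP => // jm; apply: lf; lia.
by rewrite addn0 blowupE.
Qed.

Lemma blowup_factor f : f 0%N 0%N = 0 -> exists2 u : fps2, blowup f = x * u
  & u 0%N = fpsC (f 1%N 0%N) + fpsX K * fpsC (f 0%N 1%N).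
Proof.
move=> f0; exists (blowup (shx f) + t * blowup (shy f)).
  rewrite /blowup [LHS]subst2_decomp ?vx00 ?vxt00 // f0 /cst2 !fpsC0 add0r.
  move: (subst2 x (x * t) (shx f)) (subst2 x (x * t) (shy f)) => u v.
  by ring.
by rewrite fpsD vtM !blowup_col0.
Qed.
End Blowup.

(** * The family of foliations and its invariants *)

Section Foliation.
Variable K : numFieldType.
Notation fps2 := (fps (fps K)).
Notation x := (vx K).
Notation t := (vt K).
Variable alpha : nat -> K.

Definition fx : fps2 := fun i => if i is _.+1 then fpsC (alpha i) else 0.

Notation Z := (vfield (t + fx) 1).

(** The coefficient of [x^n] in [Z G = 0] is [(n+1) t G_(n+1) + sum_k f_k (n-k+1) G_(n-k+1) + G_n' =
    0]. At [t = 0] the first term disappears and [alpha_n] occurs with factor [G_1(0)], which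
    determines it from earlier data; dividing the same relation by [(n+1) t] then gives
    [G_(n+1)]. *)
Lemma fx_rec (S : K -> Prop) (G : fps2) :
  subring_pred S -> (forall n, S n.+1%:R^-1) ->
  Z G = 0 -> fps_over S (G 0%N) -> G 1%N 0%N != 0 -> S (G 1%N 0%N)^-1 ->
  forall n, S (alpha n.+1).
Proof.
move=> subS SV ZG SG0 G1 SG1.
have subS1 := fps_over_subring subS.
have coefZ n : fpsX K * (G n.+1 *+ n.+1) +
    (\sum_(k < n.+1) fx k * (G (n - k).+1 *+ (n - k).+1) +
     fps_deriv (G n)) = 0.
  have := congr1 (fun g : fps2 => g n) ZG.
  by rewrite /vfield mul1r mulrDl !fpsD vtM fpsM addrA.
have term n k : (forall i, (i <= n)%N -> fps_over S (G i)) ->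
    (k <= n)%N -> fps_over S (fx k) ->
    fps_over S (fx k * (G (n - k).+1 *+ (n - k).+1)).
  move=> SG; case: k => [|k] kn Sf.
    by rewrite mul0r; apply: (subring_pred0 subS1).
  apply: (subring_predM subS1) => //; apply: (subring_predMn subS1).
  by apply: SG; lia.
have SGS n : (forall i, (i <= n)%N -> fps_over S (G i)) ->
    (forall i, (i <= n)%N -> fps_over S (fx i)) -> fps_over S (G n.+1).
  move=> SG Sf; have /eqP := coefZ n; rewrite addr_eq0 => /eqP E.
  have {E} SX : fps_over S (fpsX K * (G n.+1 *+ n.+1)).
    rewrite E; apply: (subring_predN subS1); apply: (subring_predD subS1).
      apply: (subring_pred_sum subS1) => k _.
      by apply: term; [|rewrite -ltnS|apply: Sf; rewrite -ltnS].
    by apply: (fps_over_deriv subS); apply: SG.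
  move=> i; have := SX i.+1; rewrite fpsXMS fpsMn => Si.
  have n0 : n.+1%:R != 0 :> K by rewrite pnatr_eq0.
  by rewrite -[G _ _](mulfK n0) mulr_natr; apply: (subring_predM subS).
have Sfx n : (forall i, (i <= n)%N -> fps_over S (G i)) ->
    (forall i, (i < n)%N -> fps_over S (fx i)) -> fps_over S (fx n).
  case: n => [|n] SG Sf; first exact: (subring_pred0 subS1).
  have := congr1 (fun g : fps K => g 0%N) (coefZ n.+1).
  rewrite !fpsD fpsXM0 add0r big_ord_recr /= subnn mulr1n fpsD fpsCM.
  move=> /eqP; rewrite -addrA addrCA addr_eq0 => /eqP E.
  apply: (fps_overC subS); rewrite -[alpha _](mulfK G1) E.
  apply: (subring_predM subS) => //; apply: (subring_predN subS).
  apply: (subring_predD subS).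
    rewrite fps_sum; apply: (subring_pred_sum subS) => k _.
    have kn := ltn_ord k; have Sk := Sf k kn.
    exact: (term n.+1 k SG (ltnW kn) Sk 0%N).
  exact: (fps_over_deriv subS (SG n.+1 (leqnn _)) 0%N).
have main n : (forall i, (i <= n)%N -> fps_over S (G i)) /\
    (forall i, (i < n)%N -> fps_over S (fx i)).
  elim: n => [|n [SG Sf]]; first by split=> // i; rewrite leqn0 => /eqP ->.
  have Sfn := Sfx n SG Sf.
  have Sf' i : (i <= n)%N -> fps_over S (fx i).
    by rewrite leq_eqVlt => /predU1P[->|/Sf].
  split=> // i; rewrite leq_eqVlt => /predU1P[->|/SG//].
  exact: SGS.
by move=> n; have [_ /(_ n.+1 (leqnn _) 0%N)] := main n.+2.
Qed.

(** The equation expresses the coefficient of [t^(n+1)] in [H] through that of lower powers,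
    dividing only by [n+1]; hence [H] stays over [S]. Such an [H] is constant on the leaves of
    [dx - rho dt = 0]. *)
Lemma first_integral (rho : fps2) : exists H : fps2,
  [/\ dt H = - (rho * dx H), forall i, H i 0%N = (i == 1%N)%:R
    & forall S, subring_pred S -> (forall n, S n.+1%:R^-1) ->
        fps_over (fps_over S) rho -> fps_over (fps_over S) H].
Proof.
(* [tab n] is final up to [t^n]: each stage overwrites one power of [t] and keeps the others, so [H]
   is read off at [tab j i j]. *)
pose fix tab n : fps2 := if n is m.+1 then
    fun i j => if j == n then - (rho * dx (tab m)) i m / n%:R else tab m i j
  else fun i j => ((i == 1) && (j == 0))%N%:R.
pose H : fps2 := fun i j => tab j i j.
have tabH n i j : (j <= n)%N -> tab n i j = H i j.
  elim: n => [|n IH]; first by case: j.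
  rewrite leq_eqVlt => /predU1P[->//|jn] /=; rewrite IH //.
  by case: eqP jn => // ->; rewrite ltnn.
have mulH n i : (rho * dx (tab n)) i n = (rho * dx H) i n.
  rewrite !fps2M; apply: eq_bigr => k _; apply: eq_bigr => l _.
  by rewrite !dxE tabH // leq_subr.
have HS i n : H i n.+1 = - (rho * dx H) i n / n.+1%:R.
  by rewrite /H /= eqxx mulH.
exists H; split=> [|i|S subS SV Srho].
- apply/funext => i; apply/funext => n; rewrite dtE -mulr_natr HS mulfVK //.
  by rewrite pnatr_eq0.
- by rewrite /H /= andbT.
have SH j : forall l i, (l <= j)%N -> S (H i l).
  elim: j => [|j IH] l i.
    rewrite leqn0 => /eqP ->; rewrite /H /= andbT; case: eqP => _.
      exact: subring_pred1.
    exact: subring_pred0.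
  rewrite leq_eqVlt => /predU1P[->|]; last exact: IH.
  rewrite HS; apply: subring_predM => //; apply: subring_predN => //.
  rewrite fps2M; apply: subring_pred_sum => // k _.
  apply: subring_pred_sum => // m _; apply: subring_predM => //.
    exact: (Srho k m).
  by rewrite dxE; apply: subring_predMn => //; apply: IH; apply: leq_subr.
by move=> i j; apply: (SH j).
Qed.
End Foliation.

(** * Conjugacies before and after the blow-up *)

Section Conjugacy.
Variable K : numFieldType.
Notation fps2 := (fps (fps K)).
Notation x := (vx K).
Notation t := (vt K).
Variable alpha : nat -> K.
Notation f := (fx alpha).

(* Here [t] stands for [y]: the same second variable is used before and after
   the blow-up. *)
Definition famA : fps2 := x * t + x ^+ 2 * f.
Definition famB : fps2 := x ^+ 3 + t ^+ 2 + x * t * f.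

Definition ftail : fps K := fun i => alpha i.+1.

Definition slice (g : fps2) : fps K := fun i => g i 0%N.

Lemma sliceM g h : slice (g * h) = slice g * slice h.
Proof.
apply/funext => i; rewrite /slice fps2M fpsM; apply: eq_bigr => k _.
by rewrite big_ord1.
Qed.
Lemma sliceD g h : slice (g + h) = slice g + slice h. Proof. by []. Qed.
Lemma slice_x : slice x = fpsX K.
Proof. by apply/funext => -[|[|i]]. Qed.
Lemma slice_t : slice t = 0.
Proof. by apply/funext => -[|i]. Qed.
Lemma slice_f : slice f = fpsX K * ftail.
Proof. by apply/funext => -[|i]; rewrite ?fpsXM0 ?fpsXMS. Qed.

Lemma fps_lead (g h : fps K) m n : (forall i, (i < m)%N -> g i = 0) ->
  (forall i, (i < n)%N -> h i = 0) -> (g * h) (m + n)%N = g m * h n.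
Proof.
move=> /fps_divXn -> /fps_divXn ->; rewrite mulrACA -exprD !fpsXnM !leqnn.
by rewrite !subnn fpsM0 !addn0.
Qed.

Variables F1 F2 P Q : fps2.
Notation a := (F1 1%N 0%N).
Notation b := (F1 0%N 1%N).
Notation c := (F2 1%N 0%N).
Notation d := (F2 0%N 1%N).
Hypotheses (F10 : F1 0%N 0%N = 0) (F20 : F2 0%N 0%N = 0).
Hypothesis det : a * d - b * c != 0.
Hypothesis conj :
  subst2 F1 F2 P * (famA * dx F1 + famB * dt F1) +
  subst2 F1 F2 Q * (famA * dx F2 + famB * dt F2) = 0.
Hypothesis (P2 : low 3 (P - t ^+ 2)) (Q2 : low 3 (Q + x * t)).

(* The coefficient of [x ^ 5] in [conj]. *)
Lemma tangent_preserved : c = 0.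
Proof.
have sA : slice famA = fpsX K ^+ 3 * ftail.
  rewrite /famA sliceD !expr2 !sliceM slice_x slice_t slice_f.
  by move: ftail => u; ring.
have sB : slice famB = fpsX K ^+ 3.
  rewrite /famB !sliceD !exprS !expr0 !mulr1 !sliceM slice_x slice_t.
  by ring.
have sV g : slice (famA * dx g + famB * dt g) = fpsX K ^+ 3 *
    (ftail * slice (dx g) + slice (dt g)).
  rewrite sliceD !sliceM sA sB.
  by move: (slice (dx g)) (slice (dt g)) ftail => u v w; ring.
have lead (g g2 : fps2) : low 3 (g - g2) -> low 2 g2 ->
    slice g = fpsX K ^+ 2 * ((fun i => g (2 + i)%N 0%N) : fps K)
    /\ g 2%N 0%N = g2 2%N 0%N.
  move=> lg lg2; have gE i : (i < 3)%N -> g i 0%N = g2 i 0%N.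
    by move=> i3; apply/subr0_eq; apply: lg; rewrite addn0.
  split; last exact: gE.
  apply: (@fps_divXn _ 2 (slice g)) => i i2.
  by rewrite /slice gE ?lg2 ?addn0 //; lia.
have lowFF (g h : fps2) : g 0%N 0%N = 0 -> h 0%N 0%N = 0 -> low 2 (g * h).
  by move=> g0 h0; apply: (@lowM _ 1 1); apply: low1.
have lP : low 3 (subst2 F1 F2 P - F2 * F2).
  have := low_subst2 F10 F20 P2.
  by rewrite subst2D subst2N subst2X // subst2_vt // expr2.
have lQ : low 3 (subst2 F1 F2 Q - - (F1 * F2)).
  have := low_subst2 F10 F20 Q2.
  by rewrite subst2D subst2M // subst2_vt // subst2_vx // opprK.
have [sP P20] := lead _ _ lP (lowFF _ _ F20 F20).
have [sQ Q20] := lead _ _ lQ (lowN (lowFF _ _ F10 F20)).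
have coef2 (g h : fps2) : g 0%N 0%N = 0 -> h 0%N 0%N = 0 ->
    (g * h) 2%N 0%N = g 1%N 0%N * h 1%N 0%N.
  move=> g0 h0; have := @fps_lead (slice g) (slice h) 1 1.
  by rewrite -sliceM; apply=> -[].
have := congr1 slice conj.
rewrite sliceD !sliceM !sV sP sQ mulrACA (mulrACA _ _ (fpsX K ^+ 3)) -mulrDr.
rewrite -exprD -[slice 0](mulr0 (fpsX K ^+ 5)) => /fpsXn_inj.
move=> /(congr1 (fun g : fps K => g 0%N)); rewrite !(fpsD, fpsM0) !addn0.
rewrite P20 Q20 fps2N !coef2 // /slice !dxE !dtE !mulr1n fps0 => E.
(* The coefficient is [c^2 (alpha_1 a + b) - a c (alpha_1 c + d)], in which [alpha_1] cancels and
   [-c (ad - bc)] remains. *)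
apply/eqP; have : c * (a * d - b * c) == 0.
  by apply/eqP; rewrite -[RHS]oppr0 -[X in _ = - X]E /ftail; ring.
by rewrite mulf_eq0 (negPf det) orbF.
Qed.

Notation Z := (vfield (t + f) 1).

Lemma blowup_conj : subst2 (blowup F1) (blowup F2) P * Z (blowup F1) +
  subst2 (blowup F1) (blowup F2) Q * Z (blowup F2) = 0.
Proof.
have x0 := vx00 K; have xt0 := vxt00 K.
have Zx : Z x = t + f by rewrite /vfield dx_vx dt_vx; ring.
have Zxt : Z (x * t) = (t + f) * t + x.
  by rewrite vfieldM Zx /vfield dx_vt dt_vt; ring.
have blf : blowup f = f.
  apply/funext => i; apply/funext => j; rewrite blowupE.
  case: i j => [|i] [|j] //=; case: leqP => // _.
  by case: (_ - _)%N.
(* The field [famA d/dx + famB d/dy] lifts to [x^2 Z]: [Z x] and [Z (xt)] are [famA] and [famB] at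
   [(x, xt)], divided by [x^2]. *)
have blV g : blowup (famA * dx g + famB * dt g) = x ^+ 2 * Z (blowup g).
  rewrite /blowup subst2_chain // Zx Zxt subst2D !subst2M // -!/(blowup _).
  have -> : blowup famA = x * (x * t) + x ^+ 2 * f.
    by rewrite /blowup subst2D !subst2M // subst2_vx // subst2_vt //
      -/(blowup f) blf.
  have -> : blowup famB = x ^+ 3 + (x * t) ^+ 2 + x * (x * t) * f.
    by rewrite /blowup !subst2D !subst2X // !subst2M // subst2_vx //
      subst2_vt // -/(blowup f) blf.
  by move: (blowup (dx g)) (blowup (dt g)) => u v; ring.
have := congr1 (@blowup K) conj.
rewrite [LHS](subst2D x (x * t)) !(subst2M x0 xt0) -!/(blowup _) !blV.
rewrite {1 3}/blowup !subst2A // -!/(blowup _) [RHS]subst2_0 => E.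
apply: (@vxn_inj _ 2); rewrite mulr0 -[RHS]E.
move: (subst2 (blowup F1) (blowup F2) P) (subst2 (blowup F1) (blowup F2) Q).
by move: (Z (blowup F1)) (Z (blowup F2)) => u v u' v'; ring.
Qed.

Variable beta : K.
Hypothesis beta0 : beta != 0.
Hypothesis E4 : low 5 (x * P + t * Q - cst2 beta * x ^+ 4).

(** The form [P dx + Q dy] lifts to [x^3 (p dx - q dt)]. Here [x^4 p] is the lift of [xP + yQ],
    whose lowest part is [beta x^4]; so [p] is a unit and [rho = q / p] exists. *)
Lemma blowup_target : exists p q rho : fps2,
  [/\ blowup Q = - (x ^+ 2 * q), blowup P = t * x ^+ 2 * q + x ^+ 3 * p,
      q 0%N = fpsX K, p 0%N 0%N != 0 & rho * p = q].
Proof.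
have x0 := vx00 K; have xt0 := vxt00 K.
have [q Qq q0] : exists2 q : fps2, blowup (- Q) = x ^+ 2 * q & q 0%N = fpsX K.
  have lQ : low 2 (- Q).
    rewrite -[Q](addrK (x * t)) opprB; apply: lowD.
      by apply: (@lowM _ 1 1); apply: low1.
    by apply: lowN; apply: low_le Q2.
  have [q Qq q0] := blowup_low lQ; exists q => //; apply/funext => j.
  rewrite q0; case: leqP => [j2|j2]; last by case: j j2 => [|[|j]].
  have /eqP : (Q + x * t) (2 - j)%N j = 0 by apply: Q2; rewrite subnK.
  rewrite fps2D addr_eq0 => /eqP QE; rewrite fps2N QE opprK.
  by move: j2 {QE}; case: j => [|[|[|j]]] // _; rewrite ?subn0 ?subnn ?vxM0 ?vxMS.
have [p Pp p0] : exists2 p : fps2, blowup (x * P + t * Q) = x ^+ 4 * p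
    & p 0%N 0%N = beta.
  have l4 : low 4 (x * P + t * Q).
    rewrite -[_ + _](subrK (cst2 beta * x ^+ 4)); apply: lowD.
      exact: low_le E4.
    by apply: (@lowM _ 0 4) => //; apply: lowX.
  have [p Pp p0] := blowup_low l4; exists p => //; rewrite p0 subn0.
  have := @E4 4%N 0%N isT; rewrite fps2D fps2N => /subr0_eq ->.
  by rewrite cst2M -[x ^+ 4]mulr1 fpsXnM /= fps2_1 mulr1.
have [pi ppi] : exists pi, p * pi = 1.
  by apply: (@fps2_inv _ _ beta^-1); rewrite p0 mulVf.
exists p, q, (q * pi); split=> //.
- by rewrite -Qq /blowup subst2N opprK.
- apply: vx_inj.
  move: Pp; rewrite /blowup subst2D !subst2M // subst2_vx // subst2_vt //.
  rewrite -!/(blowup _) (_ : blowup Q = - (x ^+ 2 * q)) ?mulrN; last first.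
    by rewrite -Qq /blowup subst2N opprK.
  by move: (blowup P) => u /eqP; rewrite subr_eq => /eqP ->; ring.
- by rewrite p0.
by rewrite -mulrA (mulrC pi) ppi mulr1.
Qed.

(** [(U, T)] with [U = blowup F1] is the lifted map. Substituting it in the lifted form turns
    [blowup_conj] into [U^3 (p(U,T) Z U - q(U,T) Z T) = 0], from which [U] is cancelled three
    times. *)
Lemma blowup_conj_target (p q T : fps2) :
  blowup Q = - (x ^+ 2 * q) -> blowup P = t * x ^+ 2 * q + x ^+ 3 * p ->
  blowup F1 != 0 -> T 0%N 0%N = 0 -> blowup F2 = blowup F1 * T ->
  subst2 (blowup F1) T p * Z (blowup F1) = subst2 (blowup F1) T q * Z T.
Proof.
move=> blQ blP U0 T0 VT; have := blowup_conj; rewrite {}VT.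
have U00 : blowup F1 0%N 0%N = 0 by rewrite blowup_col0 F10.
move: (blowup F1) U00 U0 => U U00 U0.
have bl g : subst2 U (U * T) g = subst2 U T (blowup g).
  rewrite /blowup (subst2A g (vx00 K) (vxt00 K) U00 T0) (subst2M U00 T0).
  by rewrite (subst2_vx U00 T0) (subst2_vt U00 T0).
rewrite !bl {}blQ {}blP subst2N subst2D !(subst2M U00 T0).
rewrite (subst2_vx U00 T0) (subst2_vt U00 T0) vfieldM.
move: (subst2 U T p) (subst2 U T q) (Z U) (Z T) => p' q' u v E.
apply/subr0_eq; apply: (@fps2_mulI _ U) => //; apply: (@fps2_mulI _ U) => //.
by apply: (@fps2_mulI _ U) => //; rewrite -[RHS]E; ring.
Qed.

Variables P' Q' : fps2.
Hypothesis nz : P' != 0 \/ Q' != 0.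
Hypothesis wedge0 : P' * Q - Q' * P = 0.

(** [P' dx + Q' dy] lifts to [(P' + t Q') dx + x Q' dt], proportional to [dx - rho dt]. The slope
    depends on the foliation alone, so it can be computed from the form whose coefficients are
    controlled. *)
Lemma target_slope (p q rho : fps2) :
  blowup Q = - (x ^+ 2 * q) -> blowup P = t * x ^+ 2 * q + x ^+ 3 * p ->
  rho * p = q -> p != 0 ->
  blowup P' + t * blowup Q' != 0 /\
  rho * (blowup P' + t * blowup Q') = - (x * blowup Q').
Proof.
move=> blQ blP rhop p0; have x0 := vx00 K; have xt0 := vxt00 K.
(* The coefficient of [y^2] in [P] is 1. *)
have P0 : blowup P != 0.
  apply: contraNneq (oner_neq0 K) => bP0; have := @P2 0%N 2%N isT.
  rewrite fps2D fps2N expr2 vtMS.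
  have := blowupE P 2 2; rewrite bP0 subnn /= => <-.
  by rewrite !fps0 add0r => /eqP; rewrite oppr_eq0.
have slope : rho * (blowup P' + t * blowup Q') = - (x * blowup Q').
  have := congr1 (@blowup K) wedge0.
  rewrite [RHS]subst2_0 /blowup subst2D subst2N !subst2M // -!/(blowup _).
  move=> W; apply/subr0_eq; apply: (fps2_mulI P0).
  have -> : (rho * (blowup P' + t * blowup Q') - - (x * blowup Q')) * blowup P =
      (x + rho * t) * (blowup Q' * blowup P - blowup P' * blowup Q) +
      (rho * (blowup P + t * blowup Q) + x * blowup Q) * blowup P'.
    by move: (blowup P') (blowup Q') (blowup P) (blowup Q) => A B C D; ring.
  rewrite -[_ * blowup P - _]opprB W oppr0 mulr0 add0r blP blQ -rhop.
  by move: (blowup P') => A; ring.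
split=> //; apply/eqP => N0; move: slope; rewrite N0 mulr0 => /eqP.
rewrite eq_sym oppr_eq0 => /eqP; rewrite -[X in _ = X](mulr0 x) => /vx_inj Q0.
move: N0; rewrite Q0 mulr0 addr0 => /blowup_inj P0'.
by case: nz => /eqP; [rewrite P0'|rewrite (blowup_inj Q0)].
Qed.

(** [l] allows division by [P' + t Q'] and is fixed before [S], so that [S] can later be generated
    by a finite list containing it. *)
Theorem moduli_in_subring : exists l : K, forall S : K -> Prop,
  subring_pred S -> (forall n, S n.+1%:R^-1) ->
  fps_over (fps_over S) P' -> fps_over (fps_over S) Q' ->
  S l -> S a -> S a^-1 -> S b -> S d -> forall n, S (alpha n.+1).
Proof.
have c0 := tangent_preserved.
have [p [q [rho [blQ blP q0 p00 rhop]]]] := blowup_target.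
have p0 : p != 0 by apply: contraNneq p00 => ->.
have [N0 slope] := target_slope blQ blP rhop p0.
have [l lP] := fps2_over_div N0; exists l => S subS SV SP' SQ' Sl Sa SaV Sb Sd.
have subS1 := fps_over_subring subS; have subS2 := fps_over_subring subS1.
have Sx : fps_over (fps_over S) x := fps_overX subS1.
have St : fps_over (fps_over S) t := fps_overC subS1 (fps_overX subS).
have Sxt := subring_predM subS2 Sx St.
have SbP' := subst2_over subS Sx Sxt SP'; have SbQ' := subst2_over subS Sx Sxt SQ'.
have Srho : fps_over (fps_over S) rho.
  apply: (lP S) => //.
    by apply: (subring_predD subS2) => //; apply: (subring_predM subS2).
  by rewrite slope; apply: (subring_predN subS2); apply: (subring_predM subS2).
have a0 : a != 0.
  by apply: contraNneq det => ->; rewrite c0 mul0r mulr0 subr0.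
have [u Uu u0] := blowup_factor F10; have [v Vv v0] := blowup_factor F20.
have u00 : u 0%N 0%N = a by rewrite u0 fpsD fpsXM0 addr0.
have [ui uui] : exists ui, u * ui = 1.
  by apply: (@fps2_inv _ _ a^-1); rewrite u00 mulVf.
(* Here [c = 0] is used twice: it forces [a != 0], so that [u] is invertible, and it gives
   [T(0,0) = 0], so that substituting [(U, T)] is meaningful. *)
pose T := v * ui.
have Tu : T * u = v by rewrite /T -mulrA (mulrC ui) uui mulr1.
have T00 : T 0%N 0%N = 0 by rewrite /T fps2M00 v0 fpsD fpsXM0 addr0 c0 mul0r.
have VT : blowup F2 = blowup F1 * T by rewrite Uu Vv -Tu; ring.
have U0 : blowup F1 0%N = 0 by rewrite Uu vxM0.
have U1 : blowup F1 1%N 0%N = a by rewrite Uu vxMS.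
have Un0 : blowup F1 != 0.
  by apply: contraNneq a0 => U00; rewrite -U1 U00.
(* [T(0, t) = d t / (a + b t)] is the Moebius map. *)
have ST0 : fps_over S (T 0%N).
  have SU : fps_over S (u 0%N).
    rewrite u0; apply: (subring_predD subS1); first exact: fps_overC.
    by apply: (subring_predM subS1); [exact: fps_overX|exact: fps_overC].
  apply: (@fps_over_div _ S subS (u 0%N)) => //; rewrite ?u00 //.
  rewrite -fpsM0 Tu v0 c0 fpsC0 add0r.
  by apply: (subring_predM subS1); [exact: fps_overX|exact: fps_overC].
have cUT := blowup_conj_target blQ blP Un0 T00 VT.
have [H [HE H0 SH]] := first_integral rho.
have {}SH := SH S subS SV Srho.
have U00 : blowup F1 0%N 0%N = 0 by rewrite U0.
pose G := subst2 (blowup F1) T H.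
(* At the tangency point [rho] vanishes, hence so does [H_t]; the uncontrolled [x]-derivative of [T]
   thus drops out of [G_1(0)]. *)
have rho0 : rho 0%N 0%N = 0.
  have /eqP := congr1 (fun g : fps2 => g 0%N 0%N) rhop.
  by rewrite fps2M00 q0 mulf_eq0 (negPf p00) orbF => /eqP.
have G1 : G 1%N 0%N = a.
  rewrite /G (subst2_10 U00 T00) H0 U1 mul1r.
  have := congr1 (fun g : fps2 => g 0%N 0%N) HE.
  rewrite dtE fps2N fps2M00 rho0 mul0r oppr0 mulr1n => ->.
  by rewrite mul0r addr0.
(* [Z G = H_x(U,T) (Z U - rho(U,T) Z T)], and [p(U,T)] times the bracket is zero by
   [blowup_conj_target]. *)
have ZG : Z G = 0.
  apply: (fps2_mulI (N := subst2 (blowup F1) T p)).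
    apply: contraNneq p00 => /(congr1 (fun g : fps2 => g 0%N 0%N)).
    by rewrite (subst2_00 U00 T00) => ->.
  rewrite /G (subst2_chain U00 T00) HE subst2N (subst2M U00 T00).
  move: cUT; rewrite -rhop (subst2M U00 T00).
  move: (subst2 _ T p) (subst2 _ T rho) (subst2 _ T (dx H)) => p' r h.
  move: (Z (blowup F1)) (Z T) => zU zT E.
  by rewrite mulrDl mulrAC -mulrA E; ring.
have SG0 : fps_over S (G 0%N).
  by apply: subst2_over0 => //; rewrite U0; apply: (subring_pred0 subS1).
by apply: (fx_rec subS SV ZG SG0); rewrite G1.
Qed.
End Conjugacy.

(** * Algebraic independence over the rationals *)

(** Exponent vectors of length [n] with entries below [s], nested so that the last variable splits
    off. *)
Fixpoint expo (s n : nat) : finType :=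
  if n is m.+1 then (expo s m * 'I_s)%type else unit.

Lemma card_expo s n : #|expo s n| = (s ^ n)%N.
Proof.
elim: n => [|n IH] /=; first by rewrite card_unit.
by rewrite card_prod card_ord IH expnSr.
Qed.

Section AlgebraicIndependence.
Variable K : numFieldType.
Implicit Type a : nat -> K.

Fixpoint mon a s n : expo s n -> K :=
  match n with
  | 0 => fun=> 1
  | m.+1 => fun e => mon a e.1 * a m ^+ e.2
  end.

Definition lincomb a s n (q : expo s n -> rat) : K :=
  \sum_e ratr (q e) * mon a e.

(** Any rational polynomial relation fits in such a box of exponents. *)
Definition alg_indep a :=
  forall n s (q : expo s n -> rat), lincomb a q = 0 -> forall e, q e = 0.

(** * Finitely generated algebras over the rationals *)

Section Generated.
Variables (a : nat -> K) (n : nat).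

(** With [D.+1], the largest exponent allowed is [D], and these bounds add under products. *)
Definition span D (x : K) := exists q : expo D.+1 n -> rat, x = lincomb a q.

Lemma spanD D x y : span D x -> span D y -> span D (x + y).
Proof.
move=> [q ->] [r ->]; exists (fun e => q e + r e).
by rewrite /lincomb -big_split; apply: eq_bigr => e _ /=; rewrite rmorphD mulrDl.
Qed.

Lemma spanZ D (c : rat) x : span D x -> span D (ratr c * x).
Proof.
move=> [q ->]; exists (fun e => c * q e).
by rewrite /lincomb mulr_sumr; apply: eq_bigr => e _; rewrite rmorphM mulrA.
Qed.

Lemma span0 D : span D 0.
Proof.
exists (fun=> 0); rewrite /lincomb big1 // => e _.
by rewrite rmorph0 mul0r.
Qed.

Lemma span_mon D (e : expo D.+1 n) : span D (mon a e).
Proof.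
exists (fun e' => (e' == e)%:R); rewrite /lincomb (bigD1 e) //= eqxx rmorph1.
by rewrite mul1r big1 ?addr0 // => e' /negPf->; rewrite rmorph0 mul0r.
Qed.

Lemma monM s s' m (e : expo s.+1 m) (e' : expo s'.+1 m) :
  exists e'' : expo (s + s').+1 m, mon a e'' = mon a e * mon a e'.
Proof.
elim: m e e' => [|m IH] /=; first by move=> _ _; exists tt; rewrite mulr1.
move=> [e i] [e' j] /=; have [e'' E] := IH e e'.
have ij : (i + j < (s + s').+1)%N.
  by have := ltn_ord i; have := ltn_ord j; lia.
by exists (e'', Ordinal ij) => /=; rewrite E exprD mulrACA.
Qed.

Lemma mon0 s m : exists e : expo s.+1 m, mon a e = 1.
Proof.
elim: m => [|m [e E]]; first by exists tt.
by exists (e, ord0); rewrite /= E mulr1.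
Qed.

Lemma mon1 m i : (i < m)%N -> exists e : expo 2 m, mon a e = a i.
Proof.
elim: m => // m IH; rewrite ltnS leq_eqVlt => /predU1P[->|/IH[e E]].
  by have [e E] := mon0 1 m; exists (e, ord_max); rewrite /= E mul1r expr1.
by exists (e, ord0); rewrite /= E mulr1.
Qed.

Lemma span_sum D I r (P : pred I) F :
  (forall i, P i -> span D (F i)) -> span D (\sum_(i <- r | P i) F i).
Proof. by move=> SF; apply: big_ind => //; [apply: span0|apply: spanD]. Qed.

Lemma spanM D D' x y : span D x -> span D' y -> span (D + D') (x * y).
Proof.
move=> [q ->] [r ->]; rewrite /lincomb mulr_suml; apply: span_sum => e _.
rewrite mulr_sumr; apply: span_sum => e' _.
have [e'' E] := monM e e'; rewrite mulrACA -rmorphM -E.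
by apply: spanZ; apply: span_mon.
Qed.

Lemma span1 D : span D 1.
Proof. by have [e <-] := mon0 D n; apply: span_mon. Qed.

Lemma span_le D D' x : (D <= D')%N -> span D x -> span D' x.
Proof.
by move=> /subnKC <- Sx; rewrite -[x]mulr1; apply: spanM => //; apply: span1.
Qed.

Lemma spanX D x m : span D x -> span (D * m) (x ^+ m).
Proof.
move=> Sx; elim: m => [|m IH]; first exact: span1.
by rewrite exprS mulnS; apply: spanM.
Qed.

Definition generated x := exists D, span D x.

Lemma generated_subring : subring_pred generated.
Proof.
have add x y : generated x -> generated y -> generated (x + y).
  move=> [D Sx] [D' Sy]; exists (D + D')%N; apply: spanD.
    by apply: span_le Sx; apply: leq_addr.
  by apply: span_le Sy; apply: leq_addl.
split=> [|x y Sx [D Sy]|x y [D Sx] [D' Sy]].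
- by exists 0%N; apply: span1.
- apply: add => //; exists D; rewrite -mulN1r -(rmorph1 ratr) -rmorphN.
  exact: spanZ.
by exists (D + D')%N; apply: spanM.
Qed.

Lemma generated_rat c : generated (ratr c).
Proof. by exists 0%N; rewrite -[ratr c]mulr1; apply: spanZ; apply: span1. Qed.

Lemma generated_gen i : (i < n)%N -> generated (a i).
Proof. by move=> /mon1[e <-]; exists 1%N; apply: span_mon. Qed.

Lemma generated_common (y : nat -> K) m : (forall i, generated (y i)) ->
  exists D, forall i, (i < m)%N -> span D (y i).
Proof.
move=> Gy; elim: m => [|m [D SD]]; first by exists 0%N.
have [D' Sm] := Gy m; exists (D + D')%N => i.
rewrite ltnS leq_eqVlt => /predU1P[->|/SD].
  by apply: span_le Sm; apply: leq_addl.
by apply: span_le; apply: leq_addr.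
Qed.

Lemma span_mon_of (y : nat -> K) D s m (e : expo s m) :
  (forall i, (i < m)%N -> span D (y i)) -> span (D * s * m) (mon y e).
Proof.
elim: m e => [|m IH] /=; first by move=> _ _; apply: span1.
move=> [e i] Sy /=; rewrite mulnS addnC; apply: spanM.
  by apply: IH => j jm; apply: Sy; apply: ltnW.
apply: (@span_le (D * i)); first by rewrite leq_mul2l ltnW ?orbT.
by apply: spanX; apply: Sy.
Qed.

(* There are [s ^ n.+1] monomials in [y], all in a space of dimension
   [O (s ^ n)]. *)
Lemma generated_dep (y : nat -> K) :
  (forall i, generated (y i)) -> ~ alg_indep y.
Proof.
move=> Gy ind; have [D SD] := generated_common n.+1 Gy.
(* As [M = E s], the target has dimension [(M+1)^n <= (E+1)^n s^n], which is below [s^(n+1)] because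
   [s] exceeds [(E+1)^n]. *)
pose E := (D * n.+1)%N; pose s := ((E.+1) ^ n).+1.
pose M := (D * s * n.+1)%N.
have [A AE] := choice (fun e : expo s n.+1 => span_mon_of e SD).
pose B := \matrix_(i < #|expo s n.+1|, j < #|expo M.+1 n|)
  A (enum_val i) (enum_val j).
have rk : (\rank B < #|expo s n.+1|)%N.
  apply: leq_ltn_trans (rank_leq_col B) _; rewrite !card_expo.
  have le : (M.+1 <= E.+1 * s)%N by rewrite /M /E /s; nia.
  apply: (@leq_ltn_trans ((E.+1 * s) ^ n)).
    have [n0|n0] := posnP n; last by rewrite leq_exp2r.
    by rewrite [X in (_ ^ X <= _)%N]n0 [X in (_ <= _ ^ X)%N]n0.
  by rewrite expnMn expnS ltn_pmul2r ?expn_gt0.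
(* The rows of [B] are the coordinates of the monomials in [y]; a left kernel vector is a rational
   relation between them. *)
have : kermx B != 0 by rewrite -mxrank_eq0 mxrank_ker subn_eq0 -ltnNge.
case/rowV0Pn => v /sub_kermxP vB v0.
have /ind q0 : lincomb y (fun e => v 0 (enum_rank e)) = 0.
  rewrite /lincomb (reindex (fun i : 'I_#|expo s n.+1| => enum_val i)).
    2: exact/onW_bij/enum_val_bij.
  under eq_bigr => i _ do rewrite enum_valK AE /lincomb mulr_sumr.
  rewrite exchange_big big1 // => e _.
  have vBe : \sum_i v 0 i * A (enum_val i) e = 0.
    have := congr1 (fun w : 'rV_ _ => w 0 (enum_rank e)) vB; rewrite !mxE => E0.
    by rewrite -[RHS]E0; apply: eq_bigr => i _; rewrite mxE enum_rankK.
  under eq_bigr => i _ do rewrite mulrA -rmorphM.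
  by rewrite -mulr_suml -rmorph_sum vBe rmorph0 mul0r.
case/eqP: v0; apply/rowP => i; rewrite mxE -(enum_valK i).
exact: q0.
Qed.
End Generated.

Lemma poly_roots (p : {poly K}) : p != 0 ->
  exists r : seq K, forall z, root p z -> z \in r.
Proof.
have [n] := ubnP (size p); elim: n p => // n IH p pn p0.
have [[z pz]|nz] := EM (exists z, root p z); last first.
  by exists [::] => z pz; case: nz; exists z.
have [q pq] := factor_theorem _ _ pz.
have q0 : q != 0 by apply: contraNneq p0 => q0; rewrite pq q0 mul0r.
have [|//|r Hr] := IH q.
  by move: pn; rewrite pq size_Mmonic ?monicXsubC // size_XsubC addn2 ltnS.
exists (z :: r) => w; rewrite pq rootM root_XsubC inE.
by case/orP => [/Hr ->|->]; rewrite ?orbT.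
Qed.

(** * Construction of an algebraically independent sequence *)

Section Existence.
Variable bnd : K -> Prop.
Hypothesis uncount : forall u : nat -> K, exists2 z, bnd z & forall n, z <> u n.

Lemma avoid_roots (I : countType) (p : I -> {poly K}) :
  exists2 z, bnd z & forall i, p i != 0 -> ~~ root (p i) z.
Proof.
have roots i : exists r : seq K,
    p i != 0 -> forall z, root (p i) z -> z \in r.
  have [pi0|/poly_roots[r Hr]] := eqVneq (p i) 0; first by exists [::].
  by exists r.
have [r rP] := choice roots.
(* The sequence runs through all roots of all [p i]; the default 0 merely excludes one more
   point. *)
have [z bz Hz] := uncount (fun m =>
  if unpickle m is Some (i, k) then nth 0 (r i) k else 0).
exists z => // i pi0; apply/negP => /(rP i pi0) zr.
by apply: (Hz (pickle (i, index z (r i)))); rewrite pickleK nth_index.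
Qed.

(** Codes for rational polynomials in [n + 1] variables, sorted by powers of the last. Finite
    functions make the type countable. *)
Definition extend_code n := {s : nat & {ffun 'I_s -> {ffun expo s n -> rat}}}.

Definition extend_poly a n (c : extend_code n) : {poly K} :=
  \sum_(i < tag c) (lincomb a (tagged c i))%:P * 'X^i.

Lemma lincomb_ext a (y : nat -> K) s n (q r : expo s n -> rat) :
  (forall i, (i < n)%N -> a i = y i) -> q =1 r -> lincomb a q = lincomb y r.
Proof.
move=> ay qr; apply: eq_bigr => e _; rewrite qr; congr (_ * _).
elim: n e ay {q r qr} => //= n IH [e i] ay /=.
by rewrite IH ?ay // => j jn; apply: ay; apply: ltnW.
Qed.

Lemma lincombS a s n (q : expo s n.+1 -> rat) :
  lincomb a q = \sum_(i < s) lincomb a (fun e => q (e, i)) * a n ^+ i.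
Proof.
rewrite /lincomb; under [RHS]eq_bigr => i _ do rewrite mulr_suml.
rewrite exchange_big pair_bigA /=; apply: eq_bigr => -[e i] _ /=.
by rewrite mulrA.
Qed.

(** Greedy choice: each term avoids the roots of the countably many nonzero polynomials whose
    coefficients are rational polynomials in the earlier terms. *)
Theorem exists_alg_indep : exists2 a, alg_indep a & forall n, bnd (a n).
Proof.
have next (an : (nat -> K) * nat) : exists z,
    bnd z /\ forall c : extend_code an.2,
      extend_poly an.1 c != 0 -> ~~ root (extend_poly an.1 c) z.
  by case: an => a n; have [z bz Hz] := avoid_roots (@extend_poly a n); exists z.
have [nxt nxtP] := choice next.
(* The choice of a term depends on all earlier ones, hence a list; [nth 0] makes it a sequence
   agreeing with [y] below [n]. *)
pose fix st n := if n is m.+1 then rcons (st m) (nxt (nth 0 (st m), m))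
  else [::].
have szst n : size (st n) = n by elim: n => //= n IH; rewrite size_rcons IH.
pose y n := nxt (nth 0 (st n), n).
have yst n i : (i < n)%N -> nth 0 (st n) i = y i.
  elim: n => // n IH; rewrite ltnS leq_eqVlt /= nth_rcons szst.
  by case: eqP => [->|_] /=; rewrite ?ltnn ?eqxx // => lin; rewrite lin IH.
exists y => [n|n]; last by case: (nxtP (nth 0 (st n), n)).
elim: n => [|n IH] s q.
  rewrite /lincomb /= (bigD1 tt) //= big1 ?addr0 => [|[]//] /eqP.
  by rewrite mulr1 fmorph_eq0 => /eqP q0 [].
rewrite lincombS.
pose c : extend_code n := Tagged _ [ffun i => [ffun e => q (e, i)]].
have cE i : lincomb (nth 0 (st n)) (tagged c i) =
    lincomb y (fun e => q (e, i)).
  by apply: lincomb_ext => [j /yst//|e]; rewrite !ffunE.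
(* A relation in [n + 1] terms has [y n] as a root, so its polynomial in the last variable is zero
   and each coefficient is a relation in [n] terms. *)
move=> E; have : root (extend_poly (nth 0 (st n)) c) (y n).
  rewrite /root /extend_poly horner_sum; apply/eqP; rewrite -[RHS]E.
  by apply: eq_bigr => i _; rewrite hornerM hornerC hornerXn cE.
have [_ /(_ c) H] := nxtP (nth 0 (st n), n).
move=> rt; have /eqP p0 : extend_poly (nth 0 (st n)) c == 0.
  by apply: contraTT rt; apply: H.
move=> [e i]; apply: (IH s (fun e => q (e, i))); rewrite -cE.
have := congr1 (fun p : {poly K} => p`_i) p0.
rewrite coef0 /extend_poly coef_sum (bigD1 i) //= coefCM coefXn eqxx mulr1.
rewrite big1 ?addr0 // => j; rewrite coefCM coefXn eq_sym -val_eqE /=.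
by move=> /negPf ->; rewrite mulr0.
Qed.
End Existence.
End AlgebraicIndependence.

(** * Back to the concrete complex numbers *)

Delimit Scope R_scope with Re.

(** Cantor's nested intervals. Step [n] keeps an outer closed third that misses [u n]; the middle
    third separates the two candidates. *)
Lemma real_avoids_sequence (u : nat -> R) :
  exists r : R, (0 <= r <= 1)%Re /\ forall n, r <> u n.
Proof.
pose w (I : R * R) := ((I.2 - I.1) / 3)%Re.
pose step n (I : R * R) := if Rle_dec (u n) (I.1 + w I)
  then ((I.1 + 2 * w I)%Re, I.2) else (I.1, (I.1 + w I)%Re).
pose fix I n := if n is m.+1 then step m (I m) else (0%Re, 1%Re).
have lt n : ((I n).1 < (I n).2)%Re.
  elim: n => [|n] /=; first by Lra.lra.
  by rewrite /step /w; case: Rle_dec => _ /=; Lra.lra.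
have mono n : ((I n).1 <= (I n.+1).1 /\ (I n.+1).2 <= (I n).2)%Re.
  by rewrite /= /step /w; have := lt n; case: Rle_dec => _ /=; Lra.lra.
have monoD n k : ((I n).1 <= (I (k + n)%N).1 /\ (I (k + n)%N).2 <= (I n).2)%Re.
  elim: k => [|k IH]; first by rewrite add0n; Lra.lra.
  by rewrite addSn; have := mono (k + n)%N; Lra.lra.
have nest n m : ((I n).1 <= (I m).2)%Re.
  have := monoD n m; have := monoD m n; rewrite addnC; have := lt (m + n)%N.
  by Lra.lra.
have [r [ub lub]] : {r | is_lub (fun z => exists n, z = (I n).1) r}.
  apply: completeness; last by exists (I 0%N).1; exists 0%N.
  by exists 1%Re => _ [n ->]; apply: (nest n 0%N).
have rI n : ((I n).1 <= r <= (I n).2)%Re.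
  by split; [apply: ub; exists n | apply: lub => _ [m ->]; apply: nest].
exists r; split; first exact: (rI 0%N).
move=> n; have := rI n.+1; have := lt n; rewrite /= /step /w.
by case: Rle_dec => /= H; Lra.lra.
Qed.

Notation KC := (complex R).

Definition ofC (z : C) : KC := Complex z.1 z.2.
Definition ofSer (f : Ser) : fps (fps KC) := fun i j => ofC (f i j).

Lemma ofC_inj : injective ofC.
Proof. by move=> [a b] [c d] [-> ->]. Qed.
Lemma ofCD z w : ofC (Cadd z w) = ofC z + ofC w. Proof. by []. Qed.
Lemma ofCM z w : ofC (Cmul z w) = ofC z * ofC w. Proof. by []. Qed.
Lemma ofC0 : ofC C0 = 0. Proof. by []. Qed.
Lemma ofC1 : ofC C1 = 1. Proof. by []. Qed.
Lemma ofC_nat n : ofC (INC n) = n%:R.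
Proof.
rewrite /ofC /INC /= INRE; elim: n => // n IH.
by rewrite -[in RHS]natr1 -IH; congr Complex; rewrite /= ?natr1 ?addr0.
Qed.
Lemma ofC_sum n g : ofC (Csum n g) = \sum_(k < n) ofC (g k).
Proof.
by elim: n => [|n IH] /=; rewrite ?big_ord0 // big_ord_recr /= ofCD IH.
Qed.

Lemma ofSer_inj : injective ofSer.
Proof.
move=> f g E; apply/funext => i; apply/funext => j; apply: ofC_inj.
exact: (congr1 (fun h : fps (fps KC) => h i j) E).
Qed.
Lemma ofSer0 : ofSer szero = 0. Proof. by []. Qed.
Lemma ofSerD f g : ofSer (sadd f g) = ofSer f + ofSer g. Proof. by []. Qed.
Lemma ofSerN f : ofSer (sneg f) = - ofSer f. Proof. by []. Qed.
Lemma ofSerB f g : ofSer (ssub f g) = ofSer f - ofSer g. Proof. by []. Qed.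
Lemma ofSerM f g : ofSer (smul f g) = ofSer f * ofSer g.
Proof.
apply/funext => i; apply/funext => j; rewrite fps2M /ofSer /smul ofC_sum.
by apply: eq_bigr => k _; rewrite ofC_sum.
Qed.
Lemma ofSer1 : ofSer sone = 1.
Proof. by apply/funext => -[|i]; apply/funext => -[|j]. Qed.
Lemma ofSerX f n : ofSer (spow f n) = ofSer f ^+ n.
Proof.
by elim: n => [|n IH]; [exact: ofSer1|rewrite exprS -IH -ofSerM].
Qed.
Lemma ofSer_x : ofSer sX = vx KC.
Proof. by apply/funext => -[|[|i]]; apply/funext => -[|j]. Qed.
Lemma ofSer_y : ofSer sY = vt KC.
Proof. by apply/funext => -[|i]; apply/funext => -[|[|j]]. Qed.
Lemma ofSer_scale c f : ofSer (sscale c f) = cst2 (ofC c) * ofSer f.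
Proof. by apply/funext => i; apply/funext => j; rewrite cst2M. Qed.
Lemma ofSer_dx f : ofSer (sdx f) = dx (ofSer f).
Proof.
apply/funext => i; apply/funext => j.
by rewrite dxE -mulr_natl -ofC_nat -ofCM.
Qed.
Lemma ofSer_dy f : ofSer (sdy f) = dt (ofSer f).
Proof.
apply/funext => i; apply/funext => j.
by rewrite dtE -mulr_natl -ofC_nat -ofCM.
Qed.
Lemma ofSer_comp f Phi :
  ofSer (scomp f Phi) = subst2 (ofSer Phi.1) (ofSer Phi.2) (ofSer f).
Proof.
apply/funext => i; apply/funext => j; rewrite /ofSer /scomp ofC_sum.
apply: eq_bigr => p _; rewrite ofC_sum; apply: eq_bigr => q _.
by rewrite ofCM -!ofSerX -ofSerM.
Qed.

(** By the chain rule for [Phi o Psi = id], the two Jacobian determinants at the origin have product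
    1. *)
Lemma biholomorphism_det Phi : biholomorphism Phi ->
  ofSer Phi.1 1%N 0%N * ofSer Phi.2 0%N 1%N -
  ofSer Phi.1 0%N 1%N * ofSer Phi.2 1%N 0%N != 0.
Proof.
move=> [_ [Psi [[_ [_ [G10 G20]]] [E _]]]].
pose F1 := ofSer Phi.1; pose F2 := ofSer Phi.2.
move: E; rewrite /mcomp /mid => -[E1 E2].
have G1 : ofSer Psi.1 0%N 0%N = 0 by rewrite /ofSer G10.
have G2 : ofSer Psi.2 0%N 0%N = 0 by rewrite /ofSer G20.
have e1 := subst2_10 G1 G2 F1; have e2 := subst2_01 G1 G2 F1.
have e3 := subst2_10 G1 G2 F2; have e4 := subst2_01 G1 G2 F2.
move: e1 e2 e3 e4; rewrite -!ofSer_comp E1 E2 ofSer_x ofSer_y.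
rewrite (_ : vx KC 1%N 0%N = 1) // (_ : vx KC 0%N 1%N = 0) //.
rewrite (_ : vt KC 1%N 0%N = 0) // (_ : vt KC 0%N 1%N = 1) // => e1 e2 e3 e4.
apply/eqP => det0; have /eqP := oner_neq0 KC; apply.
move: e1 e2 e3 e4 det0; rewrite -/F1 -/F2.
set a := F1 1%N 0%N; set b := F1 0%N 1%N; set c := F2 1%N 0%N; set d := F2 0%N 1%N.
set g := ofSer Psi.1 1%N 0%N; set h := ofSer Psi.2 1%N 0%N.
set g' := ofSer Psi.1 0%N 1%N; set h' := ofSer Psi.2 0%N 1%N.
move=> e1 e2 e3 e4 det0.
have : (a * g + b * h) * (c * g' + d * h') - (a * g' + b * h') * (c * g + d * h)
    = (a * d - b * c) * (g * h' - g' * h) by ring.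
by rewrite -e1 -e2 -e3 -e4 det0 !mul0r mulr1 subr0.
Qed.

Lemma low_homog (d : nat) (f g : Ser) :
  (forall i j, (i + j < d)%coq_nat -> f i j = C0) ->
  low d (ofSer g) -> homog d f = g -> low d.+1 (ofSer f - ofSer g).
Proof.
move=> f0 g0 fg i j; rewrite ltnS leq_eqVlt fps2D fps2N => /predU1P[ij|ij].
  by rewrite -fg /ofSer /homog (introT (Nat.eqb_spec _ _) ij) subrr.
by rewrite g0 // subr0 /ofSer f0 ?ofC0 //; exact/ssrnat.ltP.
Qed.

Lemma inT1_low w : inT1 w -> exists2 beta : KC, beta != 0 &
  [/\ low 3 (ofSer w.1 - vt KC ^+ 2), low 3 (ofSer w.2 + vx KC * vt KC)
    & low 5 (vx KC * ofSer w.1 + vt KC * ofSer w.2 - cst2 beta * vx KC ^+ 4)].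
Proof.
case: w => B Q /= [_ [_ [/= w0 [A2 [B2 [beta [beta0 E]]]]]]].
have lB : low 3 (ofSer B - vt KC ^+ 2).
  rewrite expr2 -ofSer_y -ofSerM; apply: low_homog B2 => [i j ij|].
    by case: (w0 i j ij).
  by rewrite ofSerM ofSer_y; apply: (@lowM _ 1 1); apply: low1.
have lQ : low 3 (ofSer Q + vx KC * vt KC).
  rewrite -[_ + _]opprK opprD -ofSerN -ofSer_x -ofSer_y -ofSerM; apply: lowN.
  apply: low_homog A2 => [i j ij|].
    by case: (w0 i j ij).
  by rewrite ofSerM ofSer_y ofSer_x; apply: (@lowM _ 1 1); apply: low1.
exists (ofC beta); first by apply/eqP => b0; apply: beta0; apply: ofC_inj.
split=> // i j; rewrite ltnS leq_eqVlt => /predU1P[ij|ij]; last first.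
  suff : low 4 (vx KC * ofSer B + vt KC * ofSer Q - cst2 (ofC beta) * vx KC ^+ 4).
    exact.
  (* The quadratic parts contribute [x y^2 - y (xy) = 0], so [xP + yQ] has order at least 4. *)
  have -> : vx KC * ofSer B + vt KC * ofSer Q - cst2 (ofC beta) * vx KC ^+ 4 =
      vx KC * (ofSer B - vt KC ^+ 2) + vt KC * (ofSer Q + vx KC * vt KC) +
      - (cst2 (ofC beta) * vx KC ^+ 4).
    by move: (ofSer B) (ofSer Q) (cst2 (ofC beta)) => u v b; ring.
  apply: lowD; last by apply: lowN; apply: lowMl; apply: lowX.
  by apply: lowD; apply: (@lowM _ 1 3) => //; apply: low1.
have := congr1 (fun f => ofSer f i j) E.
rewrite ofSer_scale ofSerB !ofSerM ofSer1 mulr1 ofSer_x ofSer_y -expr2 -!exprS.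
move=> {}E.
rewrite fps2D fps2N -E; apply/eqP; rewrite subr_eq0 !fps2D fps2N.
have h3 f k l : (k + l)%N = 3%N -> ofSer (homog 3 f) k l = ofSer f k l.
  by move=> kl; rewrite /ofSer /homog (introT (Nat.eqb_spec _ _) kl).
apply/eqP; congr (_ + _).
  by case: i ij {E} => [|i] ij; rewrite ?vxM0 ?vxMS ?h3 //; lia.
case: j ij {E} => [|j] ij; first by rewrite !vtM0 oppr0.
by rewrite !vtMS h3 ?ofSerN ?fps2N ?opprK //; lia.
Qed.

(** * The explicit foliation *)

Section Example.
Variable al : nat -> R.

Definition exA : Ser := fun i j => match i, j with
  | 1, 1 => C1 | (k.+3)%N, 0 => (al k, 0%Re) | _, _ => C0 end%N.
Definition exB : Ser := fun i j => match i, j with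
  | 3, 0 => C1 | 0, 2 => C1 | (k.+2)%N, 1 => (al k, 0%Re) | _, _ => C0 end%N.

(** [al] is indexed from 0, while [f] starts with [alpha_1 x]. *)
Let alpha k : KC := Complex (al k.-1) 0.

Lemma ofSer_exA : ofSer exA = famA alpha.
Proof.
apply/funext => i; apply/funext => j; rewrite /famA fps2D fpsXnM.
by case: i => [|[|[|i]]]; case: j => [|[|j]];
  rewrite ?vxM0 ?vxMS /= ?add0r ?addr0.
Qed.

Lemma ofSer_exB : ofSer exB = famB alpha.
Proof.
apply/funext => i; apply/funext => j; rewrite /famB !fps2D expr2 -mulrA.
rewrite -[vx KC ^+ 3]mulr1 fpsXnM.
by case: i => [|[|[|[|i]]]]; case: j => [|[|[|j]]];
  rewrite ?vxM0 ?vxMS ?vtM0 ?vtMS /= ?add0r ?addr0.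
Qed.

Hypothesis al01 : forall k, (0 <= al k <= 1)%Re.

Lemma ex_inT1 : inT1 (exB, sneg exA).
Proof.
have conv f : (forall i j, exists2 r, (0 <= r <= 1)%Re & f i j = (r, 0%Re)) ->
    convergent f.
  move=> fr; exists 1%Re, 1%Re; split=> [|i j]; first by Lra.lra.
  have [r r01 ->] := fr i j; rewrite pow1 Rmult_1_r /Cnorm -sqrt_1.
  by apply: sqrt_le_1_alt => /=; Lra.nra.
have r0 : (0 <= 0 <= 1)%Re by Lra.lra.
have r1 : (0 <= 1 <= 1)%Re by Lra.lra.
have AE : sneg (sneg exA) = exA by apply: ofSer_inj; rewrite !ofSerN opprK.
rewrite /inT1 /fst /snd AE; split.
  apply: conv => -[|[|[|i]]] [|[|j]] /=;
    by [exists 0%Re | exists 1%Re | exists (al i)].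
split.
  apply: conv => -[|[|[|[|i]]]] [|[|[|j]]] /=;
    by [exists 0%Re | exists 1%Re | exists (al i.+2) | exists (al 1%N)
       | exists (al 0%N)].
split; first by move=> [|[|i]] [|[|j]] ij; split => //; exfalso; lia.
split.
  apply: ofSer_inj; rewrite ofSerM ofSer_x ofSer_y.
  by apply/funext => -[|[|[|i]]]; apply/funext => -[|[|[|j]]];
    rewrite ?vxM0 ?vxMS.
split.
  apply: ofSer_inj; rewrite ofSerM ofSer_y.
  by apply/funext => -[|[|[|i]]]; apply/funext => -[|[|[|j]]];
    rewrite ?vtM0 ?vtMS.
(* [b_3 = x^3 + alpha_1 x^2 y] and [a_3 = alpha_1 x^3], so [x b_3 - y a_3 = x^4]. *)
exists C1; split; first by case=> /R1_neq_R0.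
apply: ofSer_inj; rewrite ofSer_scale ofSerX ofSerB !ofSerM ofSer_x ofSer_y.
rewrite ofC1 cst2_1 mul1r -[vx KC ^+ 4]mulr1.
apply/funext => i; apply/funext => j; rewrite fps2D fps2N fpsXnM.
case: i => [|[|[|[|[|i]]]]]; case: j => [|[|[|[|j]]]];
  rewrite ?vxM0 ?vxMS ?vtM0 ?vtMS /= ?subr0 ?oppr0 ?subrr //.
by rewrite /ofSer /homog; case: (Nat.eqb _ _); rewrite [ofC _]ofC0 subr0.
Qed.
End Example.

(** [w2] is the form of the target normalized as in T_1, and [w'] any polynomial form defining the
    same foliation. *)
Theorem theorem1 :
  exists w : Form, inT1 w /\
    ~ (exists (Phi : Map) (w2 w' : Form),
         biholomorphism Phi /\ inT1 w2 /\ takes_to Phi w w2 /\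
         polynomial_form w' /\ same_foliation w' w2).
Proof.
have unc (u : nat -> KC) : exists2 z : KC,
    (exists2 r : R, (0 <= r <= 1)%Re & z = Complex r 0) & forall n, z <> u n.
  have [r [r01 ru]] := real_avoids_sequence (fun n => complex.Re (u n)).
  by exists (Complex r 0); [exists r | move=> n E; apply: (ru n); rewrite -E].
have [a ind bnd] := exists_alg_indep unc.
have [al alP] := choice (fun n => let: ex_intro2 r r01 ar := bnd n in
  ex_intro (fun r => (0 <= r <= 1)%Re /\ a n = Complex r 0) r (conj r01 ar)).
have al01 k : (0 <= al k <= 1)%Re by case: (alP k).
exists (exB al, sneg (exA al)); split; first exact: ex_inT1.
move=> [Phi [w2 [w' [bih [/inT1_low[beta beta0 [lP lQ lE]] [tk [pol sf]]]]]]].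
pose alpha k : KC := Complex (al k.-1) 0.
have det := biholomorphism_det bih.
case: bih => [[_ [_ [F10 F20]]] _].
have {}F10 : ofSer Phi.1 0%N 0%N = 0 by rewrite /ofSer F10.
have {}F20 : ofSer Phi.2 0%N 0%N = 0 by rewrite /ofSer F20.
have cj : subst2 (ofSer Phi.1) (ofSer Phi.2) (ofSer w2.1) *
      (famA alpha * dx (ofSer Phi.1) + famB alpha * dt (ofSer Phi.1)) +
    subst2 (ofSer Phi.1) (ofSer Phi.2) (ofSer w2.2) *
      (famA alpha * dx (ofSer Phi.2) + famB alpha * dt (ofSer Phi.2)) = 0.
  case: tk => _ [_ /(congr1 ofSer)].
  rewrite /wedge /pullback; cbn [fst snd].
  rewrite ofSerB 2!ofSerM 2!ofSerD 4!ofSerM ofSerN ofSer_exA ofSer_exB.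
  rewrite !ofSer_comp !ofSer_dx !ofSer_dy ofSer0 -/alpha => W.
  (* The wedge with [B dx - A dy] is minus the contraction with [A d/dx + B d/dy]. *)
  apply/eqP; rewrite -oppr_eq0 -[X in _ == X]W; apply/eqP.
  move: (subst2 _ _ (ofSer w2.1)) (subst2 _ _ (ofSer w2.2)) => u v.
  by move: (famA _) (famB _) => u' v'; ring.
case: sf => [w'0 [_ wd]].
have {}wd : ofSer w'.1 * ofSer w2.2 - ofSer w'.2 * ofSer w2.1 = 0.
  by rewrite -ofSer0 -wd ofSerB !ofSerM.
have nz : ofSer w'.1 != 0 \/ ofSer w'.2 != 0.
  have [P0|] := eqVneq (ofSer w'.1) 0; last by left.
  have [Q0|] := eqVneq (ofSer w'.2) 0; last by right.
  case: w'0; case: w' P0 Q0 {pol wd} => P Q /= P0 Q0.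
  by congr (_, _); apply: ofSer_inj.
have [l lS] := moduli_in_subring F10 F20 det cj lP lQ beta0 lE nz wd.
case: pol => [[N1 pol1] [N2 pol2]].
(* A coefficient outside the box has [i + j >= N] and is zero, so finitely many generators
   suffice. *)
pose box (f : Ser) N := [seq ofSer f i j | i <- iota 0 N, j <- iota 0 N].
pose gens := box w'.1 N1 ++ box w'.2 N2 ++ [:: l; ofSer Phi.1 1%N 0%N;
  (ofSer Phi.1 1%N 0%N)^-1; ofSer Phi.1 0%N 1%N; ofSer Phi.2 0%N 1%N].
pose S := generated (nth 0 gens) (size gens).
have subS : subring_pred S := generated_subring _ _.
have Sgen z : z \in gens -> S z.
  by move=> /(nthP 0)[i ig <-]; apply: generated_gen.
have Sbox f N : (forall i j, (N <= i + j)%coq_nat -> f i j = C0) ->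
    {subset box f N <= gens} -> fps_over (fps_over S) (ofSer f).
  move=> f0 fg i j; have [ijN|ijN] := leqP N (i + j).
    by rewrite /ofSer f0; [apply: (subring_pred0 subS)|apply/ssrnat.leP].
  apply: Sgen; apply: fg; apply: allpairs_f; rewrite mem_iota; lia.
apply: (@generated_dep _ (nth 0 gens) (size gens) a) ind => n.
have -> : a n = alpha n.+1 by case: (alP n).
apply: lS => //.
- by move=> m; rewrite -ratr_nat -fmorphV; apply: generated_rat.
- by apply: Sbox pol1 _ => z; rewrite mem_cat => ->.
- by apply: Sbox pol2 _ => z; rewrite !mem_cat => ->; rewrite orbT.
all: by apply: Sgen; rewrite !mem_cat !inE eqxx !orbT.
Qed.
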